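(* Let $M$ be a smooth manifold endowed with a Finsler metric $F$ whose fundamental tensor $g$ is $C^{1,1}_{\rm loc}$ on $TM\setminus 0$ (i.e. its components are $C^1$ on $TM\setminus 0$ with locally Lipschitz derivatives), and let $N\subset M$ be a $C^{2,1}_{\rm loc}$ embedded hypersurface (i.e. $N$ is locally the inverse image of a regular value of some $C^{2,1}$ function). Let $p\in N$ and choose a transverse direction to $N$ as inner pointing in some neighborhood $U$ of $p$. If $N$ is infinitesimally convex at every point of $U\cap N$ (with respect to the chosen inner direction), then $N$ is locally convex at $p$ (and, thus, at every point of $U\cap N$).
   Context: Finsler metric. A Finsler metric on a smooth finite-dimensional manifold $M$ is a continuous function $F:TM\to[0,+\infty)$, vanishing only on the zero section, with $F(x,\lambda y)=\lambda F(x,y)$ for $\lambda>0$, regular on $TM\setminus 0$ and such that the fundamental tensor $g(x,y)=\big[\tfrac12\frac{\partial^2(F^2)}{\partial y^i\partial y^j}(x,y)\big]$ is positive definite for all $(x,y)\in TM\setminus 0$. Here the regularity required is that $g$ is $C^{1,1}_{\rm loc}$ on $TM\setminus 0$. $F$ need not be reversible; the reversed metric is $\tilde F(x,y)=F(x,-y)$. Geodesics. Geodesics are parameterized with constant speed, i.e. in local coordinates they solve $\ddot\gamma^i+\Gamma^i_{jk}(\gamma,\dot\gamma)\dot\gamma^j\dot\gamma^k=0$, where $\Gamma^i_{jk}$ are the components of the Chern connection, which satisfy $\Gamma^i_{jk}(x,y)y^jy^k=g^{ij}(x,y)\big(\tfrac12\partial_{y^jx^k}F^2(x,y)y^k-\tfrac12\partial_{x^j}F^2(x,y)\big)$.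 Let $\exp$ and $\widetilde{\exp}$ denote the exponential maps associated to the geodesics of $F$ and $\tilde F$ respectively. Finslerian Hessian. For a $C^2$ function $\phi$ and $(x,y)\in TM\setminus0$, $H_\phi(x,y)[y,y]=\frac{d^2}{ds^2}(\phi\circ\gamma)(0)$, where $\gamma$ is the geodesic of $(M,F)$ with $\gamma(0)=x$, $\dot\gamma(0)=y$. Convexity notions. Near a point $x\in U\cap N$ let $\phi$ be a $C^{2,1}$ function defined on a neighborhood $V$ of $x$ in $M$ with $\phi^{-1}(0)=V\cap N$, $d\phi\neq0$ on $V\cap N$, and $\phi>0$ on the inner side of $N$ (the side into which the chosen transverse direction points). - $N$ is infinitesimally convex at $x$ if $H_\phi(x,y)[y,y]\le 0$ for every nonzero $y\in T_xN$ (equivalently, the normal curvature of $N$ at $x$ with respect to the inner normal is non-negative; the condition does not depend on $\phi$). - $N$ is locally convex at $x$ if there is a neighborhood $O$ of $0$ in $T_xN$ such that neither $\exp_x(O)$ nor $\widetilde{\exp}_x(O)$ meets the inner side $\{\phi>0\}$ near $x$. *)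

(* Defs.v *)
From HB Require Import structures.
From mathcomp Require Import all_boot all_order all_algebra.
From mathcomp Require Import all_classical all_reals all_analysis.

Set Implicit Arguments.
Unset Strict Implicit.
Unset Printing Implicit Defensive.

Import Order.TTheory GRing.Theory Num.Theory.
Import numFieldNormedType.Exports.

Local Open Scope classical_set_scope.
Local Open Scope ring_scope.

(** The classes C^k and C^{k,1}_loc of a map on an open subset [A] of a
    finite-dimensional normed space, by recursion on all directional
    derivatives. *)
Section Regularity.
Context {R : realType} {E W : normedModType R}.
Implicit Types (A : set E) (f : E -> W).

Definition locally_lipschitz A f : Prop :=
  forall x, A x ->
    exists2 B : set E, nbhs x B & [lipschitz f z | z in A `&` B].

Fixpoint Ck (k : nat) A f : Prop :=
  match k with
  | 0 => {in A, continuous f}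
  | k'.+1 => forall v, (forall x, A x -> derivable f x v) /\
                       Ck k' A (fun x => 'D_v f x)
  end.

Fixpoint Ck1_loc (k : nat) A f : Prop :=
  match k with
  | 0 => locally_lipschitz A f
  | k'.+1 => forall v, (forall x, A x -> derivable f x v) /\
                       Ck1_loc k' A (fun x => 'D_v f x)
  end.

Definition Cinfty A f : Prop := forall k, Ck k A f.

End Regularity.

(** A smooth structure of dimension [n] on [M], given by a C^oo atlas.
    [chart c] and [chart_inv c] are total functions, meaningful only on
    [dom c] and on [chart_img c] respectively. *)
Record smooth_structure (R : realType) (n : nat) (M : topologicalType) :=
  SmoothStructure {
    chart_index : Type;
    dom : chart_index -> set M;
    chart : chart_index -> M -> 'rV[R]_n;
    chart_inv : chart_index -> 'rV[R]_n -> M;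
    mfd_hausdorff : hausdorff_space M;
    mfd_second_countable : @second_countable M;
    dom_cover : forall x, exists c, dom c x;
    dom_open : forall c, open (dom c);
    img_open : forall c, open (chart c @` dom c);
    chart_continuous : forall c, {in dom c, continuous (chart c)};
    chart_inv_continuous :
      forall c, {in chart c @` dom c, continuous (chart_inv c)};
    chartK : forall c, {in dom c, cancel (chart c) (chart_inv c)};
    transition_smooth : forall c d,
      Cinfty (chart c @` (dom c `&` dom d)) (chart d \o chart_inv c)
  }.

Section Finsler.
Context {R : realType} {n : nat} {M : topologicalType}.
Variable m : smooth_structure R n M.

Local Notation idx := (chart_index m).
Local Notation vec := 'rV[R]_n.

Definition chart_img (c : idx) : set vec := chart c @` dom c.

(** [chart_diff c d x y]: the components in the chart [d] of the tangent vector
    at [x] whose components in the chart [c] are [y]. *)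
Definition chart_diff (c d : idx) (x : M) (y : vec) : vec :=
  'D_y (chart d \o chart_inv c) (chart c x).

(** A function on TM, TM being the gluing of the sets [chart_img c * R^n] along
    the tangent maps of the changes of charts, is a family of functions of
    (position, velocity) in local coordinates that is compatible with them. *)
Definition TMfun := idx -> vec * vec -> R.

Definition TMfun_compat (F : TMfun) : Prop :=
  forall c d x y, dom c x -> dom d x ->
    F d (chart d x, chart_diff c d x y) = F c (chart c x, y).

(** TM and the slit tangent bundle TM \ 0 above the domain of [c] *)
Definition Tdom (c : idx) : set (vec * vec) := [set z | chart_img c z.1].
Definition slit_Tdom (c : idx) : set (vec * vec) :=
  [set z | chart_img c z.1 /\ z.2 <> 0].

Definition dirx (k : 'I_n) : vec * vec := (delta_mx 0 k, 0).
Definition diry (k : 'I_n) : vec * vec := (0, delta_mx 0 k).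

Definition sqF (F : TMfun) (c : idx) : vec * vec -> R := fun z => F c z ^+ 2.

Definition fundamental_tensor (F : TMfun) (c : idx) (z : vec * vec) : 'M[R]_n :=
  \matrix_(i, j)
    (2^-1 * 'D_(diry i) (fun w => 'D_(diry j) (sqF F c) w) z).

Record finsler_metric (F : TMfun) : Prop := FinslerMetric {
  F_compat : TMfun_compat F;
  F_continuous : forall c, {in Tdom c, continuous (F c)};
  F_ge0 : forall c z, Tdom c z -> 0 <= F c z;
  F_eq0 : forall c z, Tdom c z -> (F c z = 0 <-> z.2 = 0);
  F_homog : forall c x y (l : R), chart_img c x -> 0 < l ->
    F c (x, l *: y) = l * F c (x, y);
  (* the second derivatives in y of F^2 exist on TM \ 0, so that the entries of
     the fundamental tensor are not default values *)
  F_derivable1 : forall c z j, slit_Tdom c z -> derivable (sqF F c) z (diry j);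
  F_derivable2 : forall c z i j, slit_Tdom c z ->
    derivable (fun w => 'D_(diry j) (sqF F c) w) z (diry i);
  g_C11 : forall c i j,
    Ck1_loc 1 (slit_Tdom c) (fun z => fundamental_tensor F c z i j);
  g_posdef : forall c z (v : vec), slit_Tdom c z -> v <> 0 ->
    0 < (v *m fundamental_tensor F c z *m v^T) 0 0
}.

Definition reversed (F : TMfun) : TMfun := fun c z => F c (z.1, - z.2).

(** [spray F c (x, y)] has components Gamma^i_jk(x, y) y^j y^k.  At [y = 0] the
    bracket vanishes, since F^2(., 0) = 0, so that the value is 0 although the
    fundamental tensor is meaningless there: constant curves are geodesics. *)
Definition spray (F : TMfun) (c : idx) (z : vec * vec) : vec :=
  \row_i \sum_j invmx (fundamental_tensor F c z) i j *
    (2^-1 * (\sum_k 'D_(dirx k) (fun w => 'D_(diry j) (sqF F c) w) z * z.2 0 k)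
     - 2^-1 * 'D_(dirx j) (sqF F c) z).

(** [gam] is a geodesic on the open interval ]a, b[. *)
Definition geodesic (F : TMfun) (a b : R) (gam : R -> M) : Prop :=
  forall t, a < t < b ->
    {for t, continuous gam} /\
    forall c : idx, dom c (gam t) ->
      let u : R -> vec := chart c \o gam in
      let u' : R -> vec := derive1 u in
      [/\ derivable u t 1, derivable u' t 1 &
          derive1 u' t = - spray F c (u t, u' t)].

(** geodesic with initial point [x] and initial velocity [y], the latter being
    expressed in the chart [c] *)
Definition geodesic_from (F : TMfun) (c : idx) (x : M) (y : vec) (a b : R)
    (gam : R -> M) : Prop :=
  [/\ a < 0 < b, geodesic F a b gam, gam 0 = x &
      derive1 (chart c \o gam) 0 = y].

(** The image of [O] (a set of tangent vectors at [x], in the chart [c]) under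
    exp_x : y |-> gam 1, whose domain consists of the vectors [y] for which the
    geodesic with initial velocity [y] is defined up to time 1. *)
Definition exp_image (F : TMfun) (c : idx) (x : M) (O : set vec) : set M :=
  [set q | exists y a b gam,
     [/\ O y, geodesic_from F c x y a b gam, 1 < b & gam 1 = q]].

(** h = H_phi(x, y)[y, y], as a relation: the geodesic issued from (x, y) is
    unique on its interval of definition, hence so is h. *)
Definition is_hessian (F : TMfun) (phi : M -> R) (c : idx) (x : M) (y : vec)
    (h : R) : Prop :=
  exists a b gam, geodesic_from F c x y a b gam /\
                  h = derive1 (derive1 (phi \o gam)) 0.

Definition Ck1_on (k : nat) (V : set M) (phi : M -> R) : Prop :=
  forall c : idx, Ck1_loc k (chart c @` (V `&` dom c)) (phi \o chart_inv c).

(** [fdiff phi c x y] is dphi_x(y), with [y] expressed in the chart [c]. *)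
Definition fdiff (phi : M -> R) (c : idx) (x : M) (y : vec) : R :=
  'D_y (phi \o chart_inv c) (chart c x).

(** On the open set [V], [N] is the zero level of the C^{2,1} function [phi],
    which is regular along [N]. *)
Definition defining_function (N V : set M) (phi : M -> R) : Prop :=
  [/\ open V, Ck1_on 2 V phi,
      forall x, V x -> (phi x = 0 <-> N x) &
      forall x c, (V `&` N) x -> dom c x -> exists y, fdiff phi c x y <> 0].

Definition hypersurface (N : set M) : Prop :=
  forall x, N x -> exists V phi, V x /\ defining_function N V phi.

(** T_xN = ker dphi_x, for a local defining function phi of N at x *)
Definition tangent_space (N : set M) (c : idx) (x : M) : set vec :=
  [set y | exists V phi,
     [/\ V x, defining_function N V phi & fdiff phi c x y = 0]].

(** [nu c x]: the components in the chart [c] of a vector at [x]. *)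
Definition vfield := idx -> M -> vec.

(** [nu] is a continuous vector field along [U `&` N], transverse to [N]. *)
Definition transverse_field (N U : set M) (nu : vfield) : Prop :=
  [/\ forall c d x, (U `&` N) x -> dom c x -> dom d x ->
        nu d x = chart_diff c d x (nu c x),
      forall c, {within U `&` N `&` dom c, continuous (nu c)} &
      forall c x, (U `&` N) x -> dom c x -> ~ tangent_space N c x (nu c x)].

(** defining function near [x] that is positive on the side of [N] into which
    [nu] points *)
Definition inner_defining_function (N U : set M) (nu : vfield) (x : M)
    (V : set M) (phi : M -> R) : Prop :=
  [/\ V x, V `<=` U, defining_function N V phi &
      forall z c, (V `&` N) z -> dom c z -> 0 < fdiff phi c z (nu c z)].

(** The next two notions do not depend on the choice of [phi]: the first one
    asks for one [phi] and the second one for all of them, [N] being a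
    hypersurface. *)
Definition infinitesimally_convex_hypersurface (F : TMfun) (N U : set M)
    (nu : vfield) (x : M) : Prop :=
  exists V phi, inner_defining_function N U nu x V phi /\
    forall c y, dom c x -> tangent_space N c x y -> y <> 0 ->
      exists2 h, is_hessian F phi c x y h & h <= 0.

Definition locally_convex_hypersurface (F : TMfun) (N U : set M)
    (nu : vfield) (x : M) : Prop :=
  forall V phi, inner_defining_function N U nu x V phi ->
    forall c, dom c x ->
      exists2 O : set vec, nbhs (0 : vec) O &
        let O' := O `&` tangent_space N c x in
        let inner := [set z | V z /\ 0 < phi z] in
        exp_image F c x O' `&` inner = set0 /\
        exp_image (reversed F) c x O' `&` inner = set0.

End Finsler.

(* Main.v *)
Require Import Defs.
From HB Require Import structures.
From mathcomp Require Import all_boot all_order all_algebra.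
From mathcomp Require Import all_classical all_reals all_analysis.
From mathcomp Require Import ring lra.
Import Order.TTheory GRing.Theory Num.Theory.
Import numFieldNormedType.Exports.
Local Open Scope classical_set_scope.
Local Open Scope ring_scope.

(** In a chart, let [H(x,y) = d^2 phi_x(y,y) - d phi_x(S(x,y))], where [S] is the
    spray, so that [(phi o u)'' = H(u,u')] along geodesics.  By Euler's identities
    [F^2] and its [y]-derivatives are polynomial in [y] and in the fundamental
    tensor, hence [S], and with it [H], is locally Lipschitz off the zero section
    and homogeneous of degree 2.  Infinitesimal convexity says [H <= 0] on the
    tangent spaces of [N].  Moving a pair [(x,y)] near [N] to a tangent pair
    [(x1,y1)] at distance [O(|phi x| + |d phi_x y|)] yields
    [H(x,y) <= C (|phi x| |y|^2 + |d phi_x y| |y|)].  So on a short geodesic tangent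
    to [N] at its origin the function [rho = phi o u] satisfies
    [rho 0 = rho' 0 = 0] and [rho'' <= k (|rho| + |rho'|)] with [k] small, and a
    mean value argument gives [rho 1 <= 0]. *)

Set Implicit Arguments.
Unset Strict Implicit.
Unset Printing Implicit Defensive.

(** * Locally Lipschitz maps *)

Section Llip.
Context {R : realType}.

(** Three features of the hypotheses shape the proof. Regularity is expressed by directional
    derivatives taken one at a time: local Lipschitz continuity at a point, [llip], carries the
    chain rule, and the mean value theorem yields linearity in the direction. For F^2 itself only
    velocity derivatives are assumed, whereas the spray contains position derivatives; Euler's
    identities turn these into derivatives of the fundamental tensor, and the class C^{1,1} is what
    makes them locally Lipschitz. Finally, infinitesimal convexity brings its own defining function
    at each point, possibly different from the one against which local convexity is tested, so the
    Hessians of two defining functions must be compared along N. The comparison and the key estimate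
    share one device: a point is moved to N along a fixed transverse vector, by a displacement
    controlled by the value of the defining function. The reversed metric is covered by the same
    argument, its spray at (x, y) being that of F at (x, -y). *)

Definition llip {E W : normedModType R} (f : E -> W) (x : E) : Prop :=
  exists L (B : set E), [/\ 0 <= L, nbhs x B &
    forall z w, B z -> B w -> `|f z - f w| <= L * `|z - w|].

Lemma llip_continuous {E W : normedModType R} (f : E -> W) x :
  llip f x -> {for x, continuous f}.
Proof.
move=> [L [B [L0 nB H]]]; apply/cvgrPdist_le => e e0.
have L1 : 0 < L + 1 by lra.
near=> z.
have Bz : B z by near: z.
have Bx := nbhs_singleton nB.
apply: (le_trans (H _ _ Bx Bz)).
have : `|x - z| <= e / (L + 1).
  by near: z; apply: cvgr_dist_le; [exact: cvg_id|exact: divr_gt0].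
move=> h; apply: (le_trans (ler_wpM2l L0 h)).
rewrite mulrA ler_pdivrMr // mulrC ler_wpM2l ?ltW //; lra.
Unshelve. all: by end_near. Qed.

Lemma llip_near_eq {E W : normedModType R} (f g : E -> W) x :
  (\forall z \near x, f z = g z) -> llip f x -> llip g x.
Proof.
move=> fg [L [B [L0 nB H]]].
exists L, (B `&` [set z | f z = g z]); split=> //; first exact: filterI.
by move=> z w [Bz /= <-] [Bw /= <-]; exact: H.
Qed.

Lemma llip_cst {E W : normedModType R} (a : W) (x : E) : llip (fun=> a) x.
Proof.
by exists 0, setT; split=> //; [exact: filterT|move=> *; rewrite subrr normr0 mul0r].
Qed.

Lemma llip_comp {E E' W : normedModType R} (g : E -> E') (f : E' -> W) x :
  llip g x -> llip f (g x) -> llip (f \o g) x.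
Proof.
move=> lg [L [B [L0 nB H]]]; have cg := llip_continuous lg.
move: lg => [L' [B' [L0' nB' H']]].
exists (L * L'), (B' `&` g @^-1` B); split; first exact: mulr_ge0.
  by apply: filterI => //; exact: cg.
move=> z w [Bz gz] [Bw gw]; apply: (le_trans (H _ _ gz gw)).
by rewrite -mulrA ler_wpM2l // H'.
Qed.

Lemma llip_lipschitz {E W : normedModType R} (f : E -> W) L x :
  (forall z w, `|f z - f w| <= L * `|z - w|) -> llip f x.
Proof.
move=> H; exists `|L|, setT; split=> //; first exact: filterT.
move=> z w _ _; apply: (le_trans (H z w)).
by rewrite ler_wpM2r // ler_norm.
Qed.

Lemma llip_fst {E E' : normedModType R} (x : E * E') : llip fst x.
Proof.
apply: (@llip_lipschitz _ _ _ 1) => z w.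
by rewrite mul1r [leRHS]prod_normE /= le_max lexx.
Qed.

Lemma llip_snd {E E' : normedModType R} (x : E * E') : llip snd x.
Proof.
apply: (@llip_lipschitz _ _ _ 1) => z w.
by rewrite mul1r [leRHS]prod_normE /= le_max lexx orbT.
Qed.

Lemma llip_coord n (x : 'rV[R]_n) i : llip (fun z : 'rV[R]_n => z 0 i : R) x.
Proof.
apply: (@llip_lipschitz _ _ _ 1) => z w.
rewrite mul1r [leRHS]/Num.norm /= mx_normrE.
have -> : z 0 i - w 0 i = (z - w) 0 i by rewrite !mxE.
exact: (le_bigmax _ (fun ij : 'I_1 * 'I_n => `|(z - w) ij.1 ij.2|) (0, i)).
Qed.

Lemma llipD {E W : normedModType R} (f g : E -> W) x :
  llip f x -> llip g x -> llip (fun z => f z + g z) x.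
Proof.
move=> [L [B [L0 nB H]]] [L' [B' [L0' nB' H']]].
exists (L + L'), (B `&` B'); split; [exact: addr_ge0|exact: filterI|].
move=> z w [Bz Bz'] [Bw Bw'].
rewrite opprD addrACA (le_trans (ler_normD _ _)) // mulrDl lerD //.
- exact: H.
- exact: H'.
Qed.

Lemma llipM {E : normedModType R} (f g : E -> R) x :
  llip f x -> llip g x -> llip (fun z => f z * g z) x.
Proof.
move=> lf lg; have cf := llip_continuous lf; have cg := llip_continuous lg.
move: lf lg => [L [B [L0 nB H]]] [L' [B' [L0' nB' H']]].
pose Bf := [set z | `|f z| <= `|f x| + 1]; pose Bg := [set z | `|g z| <= `|g x| + 1].
have bnd (h : E -> R) : {for x, continuous h} ->
    nbhs x [set z | `|h z| <= `|h x| + 1].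
  move=> ch; near=> z => /=.
  have : `|h x - h z| <= 1 by near: z; apply: cvgr_dist_le.
  move=> h1; rewrite -lerBlDl; apply: le_trans h1.
  by rewrite distrC lerB_dist.
exists ((`|f x| + 1) * L' + (`|g x| + 1) * L), ((B `&` B') `&` (Bf `&` Bg)); split.
- by rewrite addr_ge0 // mulr_ge0 // addr_ge0.
- by apply: filterI; apply: filterI => //; exact: bnd.
- move=> z w [[Bz Bz'] [/= fz gz]] [[Bw Bw'] [/= fw gw]].
  have -> : f z * g z - f w * g w = f z * (g z - g w) + g w * (f z - f w) by ring.
  apply: (le_trans (ler_normD _ _)); rewrite mulrDl -!mulrA !normrM.
  by apply: lerD; apply: ler_pM => //; [exact: H'|exact: H].
Unshelve. all: by end_near. Qed.

Lemma llipN {E : normedModType R} (f : E -> R) x :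
  llip f x -> llip (fun z => - f z) x.
Proof.
move=> [L [B [L0 nB H]]]; exists L, B; split=> // z w Bz Bw.
by rewrite -opprD normrN; exact: H.
Qed.

Lemma llip_sum {E W : normedModType R} I (r : seq I) (P : pred I) (f : I -> E -> W) x :
  (forall i, P i -> llip (f i) x) ->
  llip (fun z => \sum_(i <- r | P i) f i z) x.
Proof.
move=> H; elim: r => [|i r IH].
  by under eq_fun do rewrite big_nil; exact: llip_cst.
case: (boolP (P i)) => Pi.
  by under eq_fun do rewrite big_cons Pi; apply: llipD => //; exact: H.
by under eq_fun do rewrite big_cons (negbTE Pi).
Qed.

Lemma llip_prod {E : normedModType R} I (r : seq I) (P : pred I) (f : I -> E -> R) x :
  (forall i, P i -> llip (f i) x) ->
  llip (fun z => \prod_(i <- r | P i) f i z) x.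
Proof.
move=> H; elim: r => [|i r IH].
  by under eq_fun do rewrite big_nil; exact: llip_cst.
case: (boolP (P i)) => Pi.
  by under eq_fun do rewrite big_cons Pi; apply: llipM => //; exact: H.
by under eq_fun do rewrite big_cons (negbTE Pi).
Qed.

Lemma llip_inv (a : R) : a != 0 -> llip (fun z : R => z^-1) a.
Proof.
move=> a0; pose c := `|a| / 2.
have c0 : 0 < c by rewrite divr_gt0 // normr_gt0.
(* Where |z| and |w| are at least c = |a| / 2, the difference |z - w| / |z w| of the inverses is at
   most c^-2 |z - w|. *)
exists (c ^- 2), [set z | c <= `|z|]; split.
- by rewrite invr_ge0 exprn_ge0 // ltW.
- near=> z => /=; have : `|a - z| <= c by near: z; apply: cvgr_dist_le.
  move=> h; rewrite -[leRHS]opprK lerNr -(lerD2l `|a|).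
  apply: (le_trans (lerB_dist _ _)); apply: (le_trans h).
  by rewrite /c; lra.
- move=> z w /= cz cw.
  have z0 : z != 0 by rewrite -normr_gt0 (lt_le_trans c0).
  have w0 : w != 0 by rewrite -normr_gt0 (lt_le_trans c0).
  have -> : z^-1 - w^-1 = (z * w)^-1 * (w - z) by field; rewrite z0 w0.
  rewrite normrM distrC ler_wpM2r // normfV lef_pV2 ?posrE.
  + by rewrite expr2 normrM ler_pM // ltW.
  + by rewrite normr_gt0 mulf_neq0.
  + by rewrite exprn_gt0.
Unshelve. all: by end_near. Qed.

Lemma llip_det {E : normedModType R} n (A : E -> 'M[R]_n) x :
  (forall i j, llip (fun z => A z i j) x) -> llip (fun z => \det (A z)) x.
Proof.
move=> H; rewrite /determinant; apply: llip_sum => s _.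
by apply: llipM; [exact: llip_cst|apply: llip_prod => i _; exact: H].
Qed.

(** Cramer's rule: the entries are cofactors over the determinant. Invertibility is asked on a
    neighborhood because [invmx] returns its argument at singular matrices. *)
Lemma llip_invmx {E : normedModType R} n (A : E -> 'M[R]_n) x :
  (forall i j, llip (fun z => A z i j) x) ->
  (\forall z \near x, A z \in unitmx) ->
  forall i j, llip (fun z => invmx (A z) i j) x.
Proof.
move=> H U i j.
apply: (@llip_near_eq _ _ (fun z => (\det (A z))^-1 *
    ((-1) ^+ (j + i) * \det (row' j (col' i (A z)))))).
  by near=> z; rewrite /invmx (near U z) // !mxE.
apply: llipM.
  apply: (llip_comp (llip_det H)); apply: llip_inv.
  by have := nbhs_singleton U; rewrite unitmxE unitfE.
apply: llipM; first exact: llip_cst.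
apply: llip_det => k l; under eq_fun do rewrite !mxE; exact: H.
Unshelve. all: by end_near. Qed.

(** Near each point of K, nearby pairs are handled by the local Lipschitz constant. A pair at
    distance at least d / 2 is handled by the bound on |f|, at the price of the constant 2 M1 / (d /
    2). Compactness makes the constant uniform. *)
Lemma llip_compact {E : normedModType R} (f : E -> R) (K : set E) :
  compact K -> (forall x, K x -> llip f x) ->
  exists L, [/\ 0 <= L, (forall z, K z -> `|f z| <= L) &
    forall z w, K z -> K w -> `|f z - f w| <= L * `|z - w|].
Proof.
move=> cK lf.
have cf : {within K, continuous f}.
  by apply: continuous_in_subspaceT => x; rewrite inE => /lf/llip_continuous.
have [M [_ HM]] := compact_bounded (continuous_compact cf cK).
pose M1 := `|M| + 1.
have fM z : K z -> `|f z| <= M1.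
  move=> Kz; apply: (HM M1); last by exists z.
  by rewrite /M1 (le_lt_trans (ler_norm _)) // ltrDl.
have M10 : 0 <= M1 by rewrite addr_ge0.
have : \forall L \near +oo, K `<=` [set z | forall w, K w ->
    `|f z - f w| <= L * `|z - w|].
  apply: ((near_covering_withinP K).2 ((compact_near_coveringP K).1 cK)) => x Kx.
  have [L [B [L0 nB H]]] := lf x Kx.
  have [d /= d0 dB] := (nbhs_ballP _ _).1 nB.
  near=> z L' => /= Kz w Kw.
  have zx : `|x - z| < d / 2.
    by near: z; apply: cvgr_dist_lt; [exact: cvg_id|exact: divr_gt0].
  have [xw|xw] := ltP `|x - w| d.
    apply: (@le_trans _ _ (L * `|z - w|)); last first.
      by rewrite ler_wpM2r //; near: L'; apply: nbhs_pinfty_ge; exact: num_real.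
    apply: H; apply: dB; rewrite -ball_normE /ball_ //=.
  have zw : d / 2 <= `|z - w|.
    have : `|x - w| <= `|x - z| + `|z - w|.
      by rewrite (le_trans _ (ler_normD _ _)) // addrA subrK.
    by move: zx xw; clear; lra.
  apply: (@le_trans _ _ (M1 + M1)).
    by rewrite (le_trans (ler_normB _ _)) // lerD // fM.
  have : (M1 + M1) / (d / 2) <= L' by near: L'; apply: nbhs_pinfty_ge; exact: num_real.
  rewrite ler_pdivrMr ?divr_gt0 // => h; apply: (le_trans h).
  have L'0 : 0 <= L' by near: L'; apply: nbhs_pinfty_ge; exact: num_real.
  by rewrite ler_wpM2l.
move=> h; near (pinfty_nbhs R) => L; exists L; split.
- by near: L; apply: nbhs_pinfty_ge; exact: num_real.
- by move=> z Kz; apply: (le_trans (fM _ Kz)); near: L; apply: nbhs_pinfty_ge; exact: num_real.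
- by move=> z w Kz Kw; exact: (near h L _ z Kz w Kw).
Unshelve. all: by end_near. Qed.

End Llip.

(** * Directional derivatives *)

Section Directional.
Context {R : realType}.

Lemma cvg_is_derive {E W : normedModType R} (f : E -> W) x v l :
  h^-1 *: (f (h *: v + x) - f x) @[h --> 0^'] --> l -> is_derive x v f l.
Proof. by move=> H; apply: DeriveDef; [exact: cvgP H|exact: cvg_lim]. Qed.

Lemma is_derive_cvg {E W : normedModType R} (f : E -> W) x v l :
  is_derive x v f l -> h^-1 *: (f (h *: v + x) - f x) @[h --> 0^'] --> l.
Proof. by move=> [d <-]; exact: d. Qed.

Lemma cvg_scale_shift {E : normedModType R} (v x : E) :
  h *: v + x @[h --> (0 : R)] --> x.
Proof.
have : h *: v + x @[h --> (0 : R)] --> 0 *: v + x.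
  by apply: cvgD; [apply: cvgZr_tmp; exact: cvg_id|exact: cvg_cst].
by rewrite scale0r add0r.
Qed.

(** Reading a directional derivative as an ordinary one along a line gives access to the
    one-variable chain rule and mean value theorem. *)
Lemma is_derive_line {E W : normedModType R} (f : E -> W) z v (t : R) l :
  is_derive (z + t *: v) v f l <-> is_derive t 1 (fun s => f (z + s *: v)) l.
Proof.
have E1 : (fun h => h^-1 *: (f (h *: v + (z + t *: v)) - f (z + t *: v))) =
  (fun h => h^-1 *: (f (z + (h *: (1 : R) + t) *: v) - f (z + t *: v))).
  by apply/funext => h; rewrite scalerDl [_%:A]mulr1 addrCA.
by split=> /is_derive_cvg H; apply: cvg_is_derive; [rewrite -E1|rewrite E1].
Qed.

Lemma is_deriveZv {E : normedModType R} (f : E -> R) x v l (a : R) :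
  is_derive x v f l -> is_derive x (a *: v) f (a * l).
Proof.
move=> H.
have : is_derive (0 : R) 1 (fun s : R => f (x + s *: (a *: v))) (a * l).
  have H0 : is_derive (a * 0) 1 (fun s => f (x + s *: v)) l.
    apply: (is_derive_line f x v (a * 0) l).1; by rewrite mulr0 scale0r addr0.
  have -> : (fun s : R => f (x + s *: (a *: v))) =
     (fun s => f (x + s *: v)) \o (fun s => a * s).
    by apply/funext => s /=; rewrite scalerA mulrC.
  have H1 : is_derive (0 : R) 1 (fun s : R => a * s) a.
    by apply: is_derive_eq; rewrite [_%:A]mulr1 ?addr0 // mulr1.
  have -> : a * l = l * a by rewrite mulrC. exact: (is_derive1_comp H0 H1).
by move=> /(is_derive_line f x (a *: v) 0 (a * l)).2; rewrite scale0r addr0.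
Qed.

Lemma MVT_line {E : normedModType R} (f : E -> R) z v :
  (forall t, 0 <= t <= 1 -> derivable f (z + t *: v) v) ->
  exists2 t, 0 <= t <= 1 & f (z + v) - f z = 'D_v f (z + t *: v).
Proof.
move=> H.
have D (t : R) : 0 <= t <= 1 ->
    is_derive t 1 (fun s => f (z + s *: v)) ('D_v f (z + t *: v)).
  by move=> t01; apply: (is_derive_line f z v t _).1; apply: derivableP; exact: H.
have [||t] := @MVT_segment _ (fun s => f (z + s *: v))
    (fun t => 'D_v f (z + t *: v)) 0 1 ler01.
- by move=> t; rewrite in_itv /= => /andP[/ltW t0 /ltW t1]; apply: D; rewrite t0.
- apply: derivable_within_continuous => t; rewrite in_itv /= => t01.
  by have := D t t01.
- rewrite in_itv /= => t01; rewrite scale1r scale0r addr0 subr0 mulr1 => ->.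
  by exists t.
Qed.

(** The increment along v + w is cut at h v + x. The first piece is the quotient along v; by the
    mean value theorem the second is h times the derivative along w at a point close to x. This
    explains the asymmetry of the hypotheses on v and w. *)
Lemma is_deriveDv {E : normedModType R} (f : E -> R) x v w a :
  is_derive x v f a -> (\forall z \near x, derivable f z w) ->
  {for x, continuous ('D_w f)} -> is_derive x (v + w) f (a + 'D_w f x).
Proof.
move=> /is_derive_cvg Ha Hw cw; apply: cvg_is_derive.
have -> : (fun h : R => h^-1 *: (f (h *: (v + w) + x) - f x)) =
  (fun h => h^-1 *: (f (h *: v + x) - f x) +
     h^-1 * (f (h *: v + x + h *: w) - f (h *: v + x))).
  have E1 (k p q r : R) : k *: (p - r) = k *: (q - r) + k * (p - q).
    by rewrite /GRing.scale /=; ring.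
  by apply/funext => h; rewrite (scalerDr h v) (addrAC (h *: v) (h *: w)); exact: E1.
apply: cvgD Ha _.
apply/cvgrPdist_le => e e0.
have [d /= d0 Hd] : exists2 d : R, 0 < d & forall z, `|x - z| < d ->
    derivable f z w /\ `|'D_w f x - 'D_w f z| <= e.
  have /nbhs_ballP[d /= d0 Hd] : \forall z \near x,
      derivable f z w /\ `|'D_w f x - 'D_w f z| <= e.
    apply: filterI Hw _; exact: ((cvgrPdist_le _ _).1 cw e e0).
  by exists d; [exact: d0|move=> z xz; apply: Hd; rewrite -ball_normE].
have D0 : 0 < `|v| + `|w| + 1 by rewrite ltr_wpDl // addr_ge0.
near=> h.
have h0 : h != 0 by near: h; exact: nbhs_dnbhs_neq.
have hd : `|h| < d / (`|v| + `|w| + 1).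
  by near: h; apply: dnbhs0_lt; exact: divr_gt0.
have near_x t : 0 <= t <= 1 -> `|x - (h *: v + x + t *: (h *: w))| < d.
  move=> /andP[t0 t1].
  have -> : x - (h *: v + x + t *: (h *: w)) = - (h *: (v + t *: w)).
    by rewrite [h *: v + x]addrC !opprD !addrA subrr sub0r scalerDr opprD
      !scalerA mulrC.
  rewrite normrN normrZ.
  have : `|v + t *: w| <= `|v| + `|w| + 1.
    rewrite ler_wpDr // (le_trans (ler_normD _ _)) // lerD2l normrZ ger0_norm //.
    by rewrite ler_piMl.
  move=> B; apply: le_lt_trans (ler_wpM2l (normr_ge0 _) B) _.
  by rewrite -ltr_pdivlMr.
have [|t t01 ->] := @MVT_line _ f (h *: v + x) (h *: w).
  move=> t t01; have [/derivableP dw _] := Hd _ (near_x t t01).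
  by case: (is_deriveZv h dw).
have [/derivableP dw dist] := Hd _ (near_x t t01).
by rewrite (derive_val (is_derive := is_deriveZv h dw)) mulKf.
Unshelve. all: by end_near. Qed.

(** Each new direction plays the role of w in [is_deriveDv], and the partial sum already treated
    that of v, for which a derivative at x suffices. *)
Lemma is_derive_sumv {E : normedModType R} (I : Type) (r : seq I) (e : I -> E)
    (c : I -> R) (f : E -> R) x :
  (forall i, \forall z \near x, derivable f z (e i)) ->
  (forall i, {for x, continuous ('D_(e i) f)}) ->
  is_derive x (\sum_(i <- r) c i *: e i) f (\sum_(i <- r) c i * 'D_(e i) f x).
Proof.
move=> H C; elim: r => [|i r IH]; first by rewrite !big_nil; exact: is_derive0.
rewrite !big_cons addrC [X in is_derive _ _ _ X]addrC.
have dZ z : derivable f z (e i) ->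
    is_derive z (c i *: e i) f (c i * 'D_(e i) f z).
  by move=> /derivableP; exact: is_deriveZv.
have Hi : \forall z \near x, derivable f z (c i *: e i).
  by apply: filterS (H i) => z /dZ[].
have Ei : \forall z \near x, c i * 'D_(e i) f z = 'D_(c i *: e i) f z.
  by apply: filterS (H i) => z /dZ[_ ->].
rewrite (nbhs_singleton Ei); apply: is_deriveDv => //.
have h : 'D_(c i *: e i) f z @[z --> x] --> c i * 'D_(e i) f x.
  apply: cvg_trans (near_eq_cvg Ei) _.
  by apply: cvgM; [exact: cvg_cst|exact: C].
by move: h; rewrite (nbhs_singleton Ei).
Qed.

(* Local Lipschitz continuity replaces Frechet differentiability of [f]. *)
Lemma is_derive_curve {E : normedModType R} (f : E -> R) (u : R -> E) t v l :
  llip f (u t) -> is_derive t 1 u v -> is_derive (u t) v f l ->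
  is_derive t 1 (f \o u) l.
Proof.
move=> [L [B [L0 nB H]]] du df.
have cu : {for t, continuous u}.
  by apply/differentiable_continuous/derivable1_diffP; case: du.
move: du df => /is_derive_cvg du /is_derive_cvg df; apply: cvg_is_derive.
apply/cvgrPdist_le => e e0.
have L1 : 0 < L + 1 by lra.
have du' : \forall h \near (0 : R)^', `|v - h^-1 *: (u (h *: 1 + t) - u t)| <= e / 2 / (L + 1).
  by apply: ((cvgrPdist_le _ _).1 du); rewrite !divr_gt0.
have df' : \forall h \near (0 : R)^', `|l - h^-1 *: (f (h *: v + u t) - f (u t))| <= e / 2.
  by apply: ((cvgrPdist_le _ _).1 df); rewrite divr_gt0.
have nB1 : \forall h \near (0 : R)^', B (u (h *: 1 + t)).
  apply: nbhs_dnbhs; suff c0 : u (h *: 1 + t) @[h --> (0 : R)] --> u t by exact: c0.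
  by apply: continuous_cvg => //; exact: (@cvg_scale_shift R^o).
have nB2 : \forall h \near (0 : R)^', B (h *: v + u t).
  by apply: nbhs_dnbhs; have c0 := @cvg_scale_shift _ v (u t); exact: c0.
near=> h.
have h0 : h != 0 by near: h; exact: nbhs_dnbhs_neq.
have d1 := near du' h; have d2 := near df' h.
have B1 := near nB1 h; have B2 := near nB2 h.
rewrite /=.
(* The quotient along the curve is compared with the one along the tangent line; their difference is
   at most L times the error in the difference quotient of u. *)
have -> : l - h^-1 *: (f (u (h *: 1 + t)) - f (u t)) =
  (l - h^-1 *: (f (h *: v + u t) - f (u t))) +
  h^-1 * (f (h *: v + u t) - f (u (h *: 1 + t))).
  have E1 (k p q r d : R) : d - k *: (p - r) = d - k *: (q - r) + k * (q - p).
    by rewrite /GRing.scale /=; ring.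
  exact: E1.
rewrite (le_trans (ler_normD _ _)) // [leRHS](splitr e) lerD //; first by apply: d2.
rewrite normrM; apply: (@le_trans _ _ (`|h^-1| * (L * `|h *: v + u t - u (h *: 1 + t)|))).
  by rewrite ler_wpM2l // H //; [apply: B2|apply: B1].
have -> : h *: v + u t - u (h *: 1 + t) = h *: (v - h^-1 *: (u (h *: 1 + t) - u t)).
  by rewrite scalerBr scalerA mulfV // scale1r opprB addrA.
rewrite normrZ mulrCA normfV mulKf ?normr_eq0 //.
have d1' : `|v - h^-1 *: (u (h *: 1 + t) - u t)| <= e / 2 / (L + 1) by apply: d1.
apply: (le_trans (ler_wpM2l L0 d1')).
rewrite mulrA ler_pdivrMr // mulrC ler_wpM2l ?divr_ge0 ?ltW //; lra.
Unshelve. all: by end_near. Qed.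

(** Mean value theorem on the segments of a ball where the partial derivatives are bounded. The
    frame [e] and its coordinates [co] are abstract in order to cover both row vectors and pairs of
    a position and a velocity. *)
Lemma llip_derive {E : normedModType R} (I : finType) (e : I -> E)
    (co : I -> E -> R) (f : E -> R) x :
  (forall v, v = \sum_i co i v *: e i) ->
  (forall i v, `|co i v| <= `|v|) ->
  (forall i, \forall z \near x, derivable f z (e i) /\
     {for z, continuous ('D_(e i) f)}) ->
  llip f x.
Proof.
move=> coE co_le H.
pose M := \sum_i (`|'D_(e i) f x| + 1).
have bnd i : \forall z \near x, `|'D_(e i) f z| <= `|'D_(e i) f x| + 1.
  have [_ c] := nbhs_singleton (H i).
  near=> z; have : `|'D_(e i) f x - 'D_(e i) f z| <= 1.
    by near: z; exact: ((cvgrPdist_le _ _).1 c).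
  by move=> h1; rewrite -lerBlDl; apply: le_trans h1; rewrite distrC lerB_dist.
have [d /= d0 Hd] : exists2 d : R, 0 < d & forall z, `|x - z| < d -> forall i,
    [/\ \forall w \near z, derivable f w (e i),
        {for z, continuous ('D_(e i) f)} &
        `|'D_(e i) f z| <= `|'D_(e i) f x| + 1].
  have : \forall z \near x, forall i, [/\ \forall w \near z, derivable f w (e i),
        {for z, continuous ('D_(e i) f)} &
        `|'D_(e i) f z| <= `|'D_(e i) f x| + 1].
    apply: filter_forall => i; near=> z; split.
    - have : \forall w \near z, derivable f w (e i) /\
         {for w, continuous ('D_(e i) f)} by near: z; apply: near_join; exact: H.
      by apply: filterS => w [].
    - by have [] := near (H i) z _.
    - by near: z; exact: bnd.
  move=> /nbhs_ballP[d /= d0 Hd].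
  by exists d; [exact: d0|move=> z xz; apply: Hd; rewrite -ball_normE].
exists M, (ball x d); split.
- by apply: sumr_ge0 => i _; rewrite addr_ge0.
- exact: nbhsx_ballx.
- rewrite -ball_normE /ball_ /= => z w xz xw.
  have seg t : 0 <= t <= 1 -> `|x - (w + t *: (z - w))| < d.
    move=> /andP[t0 t1].
    have -> : x - (w + t *: (z - w)) = (1 - t) *: (x - w) + t *: (x - z).
      rewrite scalerBl scale1r -addrA -scalerN -scalerDr opprB addrA subrK.
      by rewrite opprD addrA -scalerN opprB.
    apply: le_lt_trans (ler_normD _ _) _; rewrite !normrZ !ger0_norm ?subr_ge0 //.
    have [->|t0'] := eqVneq t 0; first by rewrite subr0 mul1r mul0r addr0.
    have tp : 0 < t by rewrite lt0r t0'.
    have := ler_wpM2l (_ : 0 <= 1 - t) (ltW xw); rewrite subr_ge0 => /(_ t1).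
    have : t * `|x - z| < t * d by rewrite ltr_pM2l.
    by move: (`|x - z|) (`|x - w|) => p q; lra.
  have D t : 0 <= t <= 1 -> is_derive (w + t *: (z - w)) (z - w) f
      (\sum_i co i (z - w) * 'D_(e i) f (w + t *: (z - w))).
    move=> t01; have Ht := Hd _ (seg t t01).
    rewrite {2}(coE (z - w)); apply: is_derive_sumv => i; by have [] := Ht i.
  have [|t t01] := @MVT_line _ f w (z - w).
    by move=> t t01; have [] := D t t01.
  rewrite [w + _]addrC subrK => ->.
  rewrite (derive_val (is_derive := D t t01)) (le_trans (ler_norm_sum _ _ _)) //.
  rewrite /M mulr_suml ler_sum // => i _; rewrite normrM mulrC ler_pM //.
  by have [] := Hd _ (seg t t01) i.
Unshelve. all: by end_near. Qed.

End Directional.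

(** * One variable *)

Section OneVariable.
Context {R : realType}.
Implicit Types f : R -> R.

(** Real induction: consider the supremum of the times t such that [P] holds on [0, t]. The third
    hypothesis puts it in that set and the second one forbids it to be less than 1. *)
Lemma segment_induction (P : R -> Prop) :
  P 0 ->
  (forall t, 0 <= t < 1 -> (forall s, 0 <= s <= t -> P s) ->
     exists2 d, 0 < d & forall s, t < s < t + d -> s <= 1 -> P s) ->
  (forall t, 0 < t <= 1 -> (forall s, 0 <= s < t -> P s) -> P t) ->
  forall t, 0 <= t <= 1 -> P t.
Proof.
move=> P0 Popen Pclosed.
pose S := [set t | 0 <= t <= 1 /\ forall s, 0 <= s <= t -> P s].
have S0 : S 0.
  split; first by rewrite lexx ler01.
  by move=> s; rewrite -eq_le => /eqP <-.
have hS : has_sup S.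
  by split; [exists 0|exists 1 => t [/andP[_ t1] _]].
have T0 : 0 <= sup S by apply: ub_le_sup S0; case: hS.
have T1 : sup S <= 1 by apply: ge_sup; [exists 0|move=> t [/andP[_ t1] _]].
have below s : 0 <= s < sup S -> P s.
  move=> /andP[s0 sS].
  have [t [_ tP] st] : exists2 t, S t & s < t.
    by have [t St] := sup_gt hS.1 sS; exists t.
  by apply: tP; rewrite s0 ltW.
have PT : P (sup S).
  have [->//|T0'] := eqVneq (sup S) 0.
  by apply: Pclosed => //; rewrite T1 lt0r T0' T0.
have upto s : 0 <= s <= sup S -> P s.
  move=> /andP[s0]; rewrite le_eqVlt => /orP[/eqP ->//|sT].
  by apply: below; rewrite s0.
have [T_1 t|T_n1] := eqVneq (sup S) 1; first by rewrite -T_1; exact: upto.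
have Tlt1 : sup S < 1 by rewrite lt_neqAle T_n1.
have [|d d0 Pd] := Popen (sup S) _ upto; first by rewrite T0.
pose t := Num.min (sup S + d / 2) 1.
have tT : sup S < t by rewrite lt_min Tlt1 andbT ltrDl divr_gt0.
have td : t < sup S + d.
  by rewrite gt_min ltrD2l ltr_pdivrMr // ltr_pMr // ltr1n.
have t1 : t <= 1 by rewrite ge_min lexx orbT.
have St : S t.
  split; first by rewrite t1 (le_trans T0) // ltW.
  move=> s /andP[s0 st]; have [sT|sT] := leP s (sup S).
    by apply: upto; rewrite s0.
  by apply: Pd; [rewrite sT (le_lt_trans st)|exact: le_trans st t1].
by have := ub_le_sup hS.2 St; rewrite leNgt tT.
Qed.

(** The point is the supremum of the times of [a, b] where f <= 0; continuity gives f <= 0 there as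
    well. *)
Lemma last_nonpositive f (a b : R) :
  a <= b -> (forall t, a <= t <= b -> {for t, continuous f}) ->
  f a <= 0 -> 0 < f b ->
  exists c, [/\ a <= c < b, f c <= 0 & forall t, c < t <= b -> 0 < f t].
Proof.
move=> ab cf fa fb.
pose S := [set t | a <= t <= b /\ f t <= 0].
have Sa : S a by split=> //; rewrite lexx.
have hS : has_sup S by split; [exists a|exists b => t [/andP[]]].
have Ta : a <= sup S by apply: ub_le_sup Sa; case: hS.
have Tb : sup S <= b by apply: ge_sup; [exists a|move=> t [/andP[]]].
have fT : f (sup S) <= 0.
  rewrite leNgt; apply/negP => fT.
  have : \forall t \near sup S, 0 < f t.
    by apply: (cvgr_gt _ (cf _ _)) => //; rewrite Ta.
  move=> /nbhs_ballP[d /= d0 Hd].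
  have [t St tT] := sup_adherent d0 hS.
  have : 0 < f t.
    apply: Hd; rewrite -ball_normE /ball_ /= ger0_norm.
      by rewrite ltrBlDl -ltrBlDr.
    by rewrite subr_ge0 ub_le_sup //; case: hS.
  by case: St => _; rewrite leNgt => /negP.
exists (sup S); split=> //.
  by rewrite Ta lt_neqAle Tb andbT; apply: contraTneq fb => <-; rewrite -leNgt.
move=> t /andP[tT tb]; rewrite ltNge; apply/negP => ft.
have St : S t by split=> //; rewrite tb (le_trans Ta) // ltW.
by have := ub_le_sup hS.2 St; rewrite leNgt tT.
Qed.

(* Let [m] be the maximum of [f'] after the minimum point of [f]. If [f 1 > 0],
   then [|f| <= m] wherever [f' >= 0] there, so that [f'' <= 2 k m < m] while
   [f'] rises from [0] to [m]. *)
Lemma second_order_comparison (f f1 f2 : R -> R) (k : R) :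
  0 <= k -> k < 2^-1 ->
  (forall t : R, 0 <= t <= 1 -> is_derive t 1 f (f1 t)) ->
  (forall t : R, 0 <= t <= 1 -> is_derive t 1 f1 (f2 t)) ->
  f 0 = 0 -> f1 0 = 0 ->
  (forall t, 0 <= t <= 1 -> f2 t <= k * (`|f t| + `|f1 t|)) ->
  f 1 <= 0.
Proof.
move=> k0 k2 df df1 f0 f10 Hf2; rewrite leNgt; apply/negP => f1p.
have cdf (g g' : R -> R) (t : R) : is_derive t 1 g (g' t) -> {for t, continuous g}.
  by move=> [dg _]; apply/differentiable_continuous/derivable1_diffP.
have MV (g g' : R -> R) (a b : R) : (forall t : R, 0 <= t <= 1 -> is_derive t 1 g (g' t)) ->
    0 <= a -> a <= b -> b <= 1 ->
    exists2 c, a <= c <= b & g b - g a = g' c * (b - a).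
  move=> dg a0 ab b1.
  have [||c] := @MVT_segment _ g g' a b ab.
  - move=> t; rewrite in_itv /= => /andP[ta tb]; apply: dg.
    by rewrite (le_trans a0 (ltW ta)) (le_trans (ltW tb) b1).
  - apply: derivable_within_continuous => t; rewrite in_itv /= => /andP[ta tb].
    have := dg t; rewrite (le_trans a0 ta) (le_trans tb b1) => /(_ isT) h.
    by case: h.
  - by rewrite in_itv /=; exists c.
have wc (g g' : R -> R) (a b : R) : (forall t : R, 0 <= t <= 1 -> is_derive t 1 g (g' t)) ->
    0 <= a -> b <= 1 -> {within `[a, b], continuous g}.
  move=> dg a0 b1; apply: derivable_within_continuous => t.
  rewrite in_itv /= => /andP[ta tb].
  have := dg t; rewrite (le_trans a0 ta) (le_trans tb b1) => /(_ isT) h.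
  by case: h.
have [t0] := EVT_min ler01 (wc _ _ 0 1 df (lexx _) (lexx _)).
rewrite in_itv /= => /andP[t00 t01] mint0.
have ft0 : f t0 <= 0.
  by rewrite -f0; apply: mint0; rewrite in_itv /= lexx ler01.
have t0lt1 : t0 < 1.
  by rewrite lt_neqAle t01 andbT; apply: contraTneq f1p => <-; rewrite -leNgt.
(* By hypothesis if t0 = 0; otherwise t0 is an interior minimum and the derivative vanishes. *)
have f1t0 : f1 t0 <= 0.
  have [->|t0n0] := eqVneq t0 0; first by rewrite f10.
  have t0p : 0 < t0 by rewrite lt0r t0n0.
  have d0 : is_derive t0 1 f 0.
    apply: (@derive1_at_min _ f 0 1 t0 ler01).
    - move=> t; rewrite in_itv /= => /andP[/ltW tp /ltW t1].
      by have := df t; rewrite tp t1 => /(_ isT) h; case: h.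
    - by rewrite in_itv /= t0p.
    - move=> t; rewrite in_itv /= => /andP[/ltW tp /ltW t1].
      by apply: mint0; rewrite in_itv /= tp.
  have d1 : is_derive t0 1 f (f1 t0) by apply: df; rewrite t00.
  by rewrite -(derive_val (is_derive := d1)) (derive_val (is_derive := d0)).
have [s] := EVT_max t01 (wc _ _ t0 1 df1 t00 (lexx _)).
rewrite in_itv /= => /andP[st0 s1] maxs.
have rise b : t0 <= b <= 1 -> f b - f t0 <= f1 s * (b - t0).
  move=> /andP[tb b1]; have [c /andP[c1 c2] ->] := MV _ _ _ _ df t00 tb b1.
  rewrite ler_wpM2r ?subr_ge0 //; apply: maxs.
  by rewrite in_itv /= c1 (le_trans c2).
have mp : 0 < f1 s.
  have := rise 1; rewrite t01 lexx => /(_ isT) h.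
  have : 0 < f1 s * (1 - t0) by apply: lt_le_trans h; lra.
  by rewrite pmulr_lgt0 // subr_gt0.
(* After the last time c before s with f' <= 0, the derivative stays in ]0, m], where m = f1 s. *)
have [|c [/andP[tc cs] f1c f1pos]] := @last_nonpositive f1 t0 s st0 _ f1t0 mp.
  move=> t /andP[t0t ts]; apply: (cdf _ f2); apply: df1.
  by rewrite (le_trans t00 t0t) (le_trans ts s1).
have c0 := le_trans t00 tc.
have [||x] := @MVT _ f1 f2 c s cs.
- move=> t; rewrite in_itv /= => /andP[/ltW ct /ltW ts]; apply: df1.
  by rewrite (le_trans c0 ct) (le_trans ts).
- exact: wc df1 c0 s1.
rewrite in_itv /= => /andP[cx xs] Ex.
have x01 : 0 <= x <= 1 by rewrite (le_trans c0 (ltW cx)) (le_trans (ltW xs)).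
have t0x : t0 <= x by rewrite (le_trans tc) // ltW.
have f1x : 0 < f1 x by apply: f1pos; rewrite cx ltW.
have f1xm : f1 x <= f1 s.
  by apply: maxs; rewrite in_itv /= t0x; case/andP: x01.
(* Above, f x <= f t0 + m <= m; below, f x >= f t0 >= f 1 - m > - m. *)
have fxm : `|f x| <= f1 s.
  have := rise 1; rewrite t01 lexx => /(_ isT).
  have := rise x; rewrite t0x (andP x01).2 => /(_ isT).
  have : f t0 <= f x by apply: mint0; rewrite in_itv.
  have : f1 s * (x - t0) <= f1 s.
    by rewrite ler_piMr ?(ltW mp) // lerBlDr (le_trans (andP x01).2) // lerDl.
  have : f1 s * (1 - t0) <= f1 s.
    by rewrite ler_piMr ?(ltW mp) // gerBl.
  by rewrite ler_norml; move: ft0 f1p; clear; move=> *; apply/andP; split; lra.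
have f2x : f2 x <= k * (f1 s + f1 s).
  by apply: (le_trans (Hf2 _ x01)); rewrite ler_wpM2l // lerD // gtr0_norm.
(* The contradiction is m <= f1 s - f1 c = f2 x (s - c) <= 2 k m < m. *)
have : f2 x * (s - c) <= k * (f1 s + f1 s) * (s - c).
  by rewrite ler_wpM2r // subr_ge0 ltW.
have : k * (f1 s + f1 s) * (s - c) <= k * (f1 s + f1 s).
  rewrite ler_piMr //; last by rewrite lerBlDr (le_trans s1) // lerDl.
  by rewrite mulr_ge0 // addr_ge0 // ltW.
have : k * f1 s < 2^-1 * f1 s by rewrite ltr_pM2r.
by move: Ex f1c; clear; move=> *; lra.
Qed.

End OneVariable.

(** * The Hessian near a convex hypersurface *)

(** The near-covering form of compactness is used twice: over B, uniformly near a fixed point of A,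
    and then over A. *)
Lemma compact_setM {X Y : topologicalType} (A : set X) (B : set Y) :
  compact A -> compact B -> compact (A `*` B).
Proof.
move=> /compact_near_coveringP cA /compact_near_coveringP cB.
apply/compact_near_coveringP => I F P FF H.
have : \forall i \near F, A `<=` [set a | forall b, B b -> P i (a, b)].
  apply: cA => x Ax.
  have := cB _ (filter_prod (nbhs x) F) (fun p b => P p.2 (p.1, b)) _.
  apply => y By.
  have [[U V] /= [[[U1 U2] /= [nU1 nU2] HU] FV] HP] := H (x, y) (conj Ax By).
  exists (U2, U1 `*` V) => /=.
    by split=> //; exists (U1, V).
  move=> [b [a i]] /= [bU2 [aU1 iV]].
  by apply: (HP ((a, b), i)); split=> //; apply: HU.
by apply: filterS => i Hi [a b] [Aa Bb]; exact: Hi.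
Qed.

Section KeyEstimate.
Context {R : realType} {n : nat}.
Local Notation vec := 'rV[R]_n.

Lemma mx_norm_le (v : vec) (c : R) :
  0 <= c -> (forall i, `|v 0 i| <= c) -> `|v| <= c.
Proof.
move=> c0 H; rewrite /Num.norm /= mx_normrE; apply: bigmax_le => // -[i j] _ /=.
by rewrite (ord1 i).
Qed.

Lemma rV_closed_ball_compact (x : vec) (r : R) : compact [set w | `|x - w| <= r].
Proof.
apply: bounded_closed_compact; last exact: closed_closed_ball_.
exists (`|x| + r); split=> [|B ltB w /= wr]; first exact: num_real.
apply: ltW; apply: le_lt_trans ltB; rewrite -lerBlDl (le_trans _ wr) //.
by rewrite distrC lerB_dist.
Qed.

Lemma coord_le (v : vec) i : `|v 0 i| <= `|v|.
Proof.
rewrite [leRHS]/Num.norm /= mx_normrE.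
exact: (le_bigmax _ (fun ij : 'I_1 * 'I_n => `|v ij.1 ij.2|) (0, i)).
Qed.

(** What the estimates use of a C^{2,1} function in coordinates: [a] is the gradient and [b i j] the
    derivative of [a i] in the j-th direction. The formulas for all directions v record that
    derivatives are linear in v. *)
Record C21 (A : set vec) (f : vec -> R) (a : 'I_n -> vec -> R)
    (b : 'I_n -> 'I_n -> vec -> R) : Prop := {
  C21_open : open A;
  C21_derive : forall x v, A x -> is_derive x v f (\sum_i v 0 i * a i x);
  C21_derive2 : forall i x v, A x ->
    is_derive x v (a i) (\sum_j v 0 j * b i j x);
  C21_llip : forall x, A x -> llip f x;
  C21_llip1 : forall i x, A x -> llip (a i) x;
  C21_llip2 : forall i j x, A x -> llip (b i j) x }.

Variables (A : set vec) (f : vec -> R) (a : 'I_n -> vec -> R)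
  (b : 'I_n -> 'I_n -> vec -> R).
Hypothesis fC : C21 A f a b.

Definition d1 x (y : vec) : R := \sum_i y 0 i * a i x.
Definition d2 x (y : vec) : R := \sum_i y 0 i * \sum_j y 0 j * b i j x.
(* The second derivative of [f] along the solutions of [u'' = - S (u, u')]. *)
Definition hess (S : vec * vec -> vec) x y : R := d2 x y - d1 x (S (x, y)).

Lemma d1Z x k y : d1 x (k *: y) = k * d1 x y.
Proof. by rewrite /d1 mulr_sumr; apply: eq_bigr => i _; rewrite mxE mulrA. Qed.

Lemma d1B x y z : d1 x (y - z) = d1 x y - d1 x z.
Proof.
by rewrite /d1 -sumrB; apply: eq_bigr => i _; rewrite !mxE mulrBl.
Qed.

Lemma d1N x y : d1 x (- y) = - d1 x y.
Proof. by rewrite -scaleN1r d1Z mulN1r. Qed.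

Lemma d2Z x k y : d2 x (k *: y) = k ^+ 2 * d2 x y.
Proof.
rewrite /d2 mulr_sumr; apply: eq_bigr => i _; rewrite mxE !mulr_sumr.
by apply: eq_bigr => j _; rewrite mxE; ring.
Qed.

Section Projection.
Variables (S : vec * vec -> vec).
Hypothesis S_llip : forall z i, A z.1 -> z.2 <> 0 -> llip (fun w => S w 0 i) z.
Hypothesis S_homog : forall x y l, A x -> y <> 0 -> 0 < l ->
  S (x, l *: y) = l ^+ 2 *: S (x, y).
Hypothesis S0 : forall x, A x -> S (x, 0) = 0.
Hypothesis convex : forall x y, A x -> f x = 0 -> d1 x y = 0 -> y <> 0 ->
  hess S x y <= 0.

Lemma hessZ x y l : A x -> y <> 0 -> 0 < l ->
  hess S x (l *: y) = l ^+ 2 * hess S x y.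
Proof.
by move=> Ax y0 l0; rewrite /hess S_homog // d1Z d2Z mulrBr.
Qed.

Lemma llip_d1 (z : vec * vec) : A z.1 -> llip (fun w : vec * vec => d1 w.1 w.2) z.
Proof.
move=> Az; apply: llip_sum => i _; apply: llipM.
  exact: (llip_comp (llip_snd z) (llip_coord _ _)).
exact: (llip_comp (llip_fst z) (C21_llip1 fC i Az)).
Qed.

Lemma llip_hess (z : vec * vec) : A z.1 -> z.2 <> 0 ->
  llip (fun w : vec * vec => hess S w.1 w.2) z.
Proof.
move=> Az z2.
have cs i : llip (fun w : vec * vec => w.2 0 i) z.
  exact: (llip_comp (llip_snd z) (llip_coord _ _)).
apply: llipD.
  apply: llip_sum => i _; apply: llipM => //.
  apply: llip_sum => j _; apply: llipM => //.
  exact: (llip_comp (llip_fst z) (C21_llip2 fC i j Az)).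
apply: llipN; apply: llip_sum => i _; apply: llipM.
  have -> : (fun w : vec * vec => S (w.1, w.2) 0 i) = (fun w => S w 0 i).
    by apply/funext => -[].
  exact: S_llip.
exact: (llip_comp (llip_fst z) (C21_llip1 fC i Az)).
Qed.

Variables (x0 e : vec).
Hypotheses (Ax0 : A x0) (fx0 : f x0 = 0) (de : 0 < d1 x0 e).

(** A quantitative implicit function theorem: near x0 the derivative along e is at least c0, so f (x
    + s e) grows in s with slope at least c0 and changes sign for |s| <= |f x| / c0. The larger
    radius r0 leaves room for the displaced point. *)
Lemma project_point : exists r0 r c0 : R, [/\ 0 < r0, 0 < r <= r0, 0 < c0,
  (forall x, `|x0 - x| <= r0 -> A x /\ c0 <= d1 x e) &
  forall x, `|x0 - x| <= r ->
    exists s, [/\ `|s| <= `|f x| / c0, f (x + s *: e) = 0 &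
                  `|x0 - (x + s *: e)| <= r0]].
Proof.
have c0p : 0 < d1 x0 e / 2 by rewrite divr_gt0.
have llx0 : llip (fun x => d1 x e) x0.
  apply: llip_sum => i _; apply: llipM; first exact: llip_cst.
  exact: (C21_llip1 fC i Ax0).
have [r0 r0p H0] : exists2 r0 : R, 0 < r0 & forall x, `|x0 - x| <= r0 ->
    A x /\ d1 x0 e / 2 <= d1 x e.
  have : \forall x \near x0, A x /\ d1 x0 e / 2 <= d1 x e.
    apply: filterI; first exact: open_nbhs_nbhs (conj (C21_open fC) Ax0).
    have : \forall x \near x0, d1 x0 e / 2 < d1 x e.
      apply: (cvgr_gt _ (llip_continuous llx0)).
      by rewrite ltr_pdivrMr // ltr_pMr // ltr1n.
    by apply: filterS => x /ltW.
  move=> /nbhs_ballP[d /= d0 Hd]; exists (d / 2); first by rewrite divr_gt0.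
  move=> x xd; apply: Hd; rewrite -ball_normE /ball_ /=.
  by rewrite (le_lt_trans xd) // ltr_pdivrMr // ltr_pMr // ltr1n.
set c0 := d1 x0 e / 2 in c0p H0 *.
have dpos : 0 < r0 / 2 / (`|e| + 1) * c0.
  by rewrite mulr_gt0 // !divr_gt0 // ltr_wpDl.
(* This bound on |f x| keeps the displacement |f x| / c0 * |e| below r0 / 2. *)
have [r rp Hr] : exists2 r : R, 0 < r & forall x, `|x0 - x| <= r ->
    `|f x| <= r0 / 2 / (`|e| + 1) * c0.
  have cf := llip_continuous (C21_llip fC Ax0).
  have : \forall x \near x0, `|f x0 - f x| <= r0 / 2 / (`|e| + 1) * c0.
    exact: ((cvgrPdist_le _ _).1 cf).
  move=> /nbhs_ballP[d /= d0 Hd]; exists (d / 2); first by rewrite divr_gt0.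
  move=> x xd; have := Hd x; rewrite /= fx0 sub0r normrN; apply.
  rewrite -ball_normE /ball_ /=.
  by rewrite (le_lt_trans xd) // ltr_pdivrMr // ltr_pMr // ltr1n.
exists r0, (Num.min r (r0 / 2)), c0; split=> //.
  rewrite lt_min rp divr_gt0 //= ge_min; apply/orP; right.
  by rewrite ler_pdivrMr // ler_pMr // ler1n.
move=> x; rewrite le_min => /andP[xr xr0].
have fxr := Hr x xr.
pose sg := `|f x| / c0.
have sg0 : 0 <= sg by rewrite divr_ge0 // ltW.
have seg s : `|s| <= sg -> `|x0 - (x + s *: e)| <= r0.
  move=> ssg; rewrite opprD addrA (le_trans (ler_normB _ _)) // (splitr r0) lerD //.
  rewrite normrZ; apply: (@le_trans _ _ (sg * (`|e| + 1))).
    by rewrite ler_pM // lerDl.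
  have e1 : 0 < `|e| + 1 by rewrite ltr_wpDl.
  by rewrite -ler_pdivlMr // /sg ler_pdivrMr.
have dg (s : R) : `|s| <= sg -> is_derive s 1 (fun s => f (x + s *: e)) (d1 (x + s *: e) e).
  move=> /seg/H0[Axs _].
  by have := C21_derive fC e Axs; move=> /(is_derive_line f x e s _).1.
have MV (p q : R) : `|p| <= sg -> `|q| <= sg -> p <= q ->
    f (x + p *: e) + c0 * (q - p) <= f (x + q *: e).
  move=> psg qsg pq.
  have mid s : p <= s <= q -> `|s| <= sg.
    move=> /andP[ps sq]; move: psg qsg; rewrite !ler_norml.
    move=> /andP[p1 _] /andP[_ q1].
    by rewrite (le_trans p1) // (le_trans sq).
  have [||s] := @MVT_segment _ (fun s => f (x + s *: e))
    (fun s => d1 (x + s *: e) e) p q pq.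
  - move=> s; rewrite in_itv /= => /andP[/ltW ps /ltW sq].
    by apply: dg; apply: mid; rewrite ps.
  - apply: derivable_within_continuous => s; rewrite in_itv /= => /mid/dg.
    by move=> h; case: h.
  rewrite in_itv /= => /mid/seg/H0[_ ds] E.
  have : c0 * (q - p) <= f (x + q *: e) - f (x + p *: e).
    by rewrite E ler_wpM2r // subr_ge0.
  by move=> h; rewrite addrC -lerBrDr.
have sgsg : `|sg| <= sg by rewrite ger0_norm.
have Nsgsg : `|- sg| <= sg by rewrite normrN.
have z0 : `|0 : R| <= sg by rewrite normr0.
have c0sg : c0 * sg = `|f x| by rewrite /sg mulrC divfK // gt_eqF.
have lo : f (x + - sg *: e) <= 0.
  have := MV (- sg) 0 Nsgsg z0; rewrite oppr_le0 => /(_ sg0).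
  rewrite scale0r addr0 sub0r opprK c0sg.
  by have := ler_norm (f x); lra.
have hi : 0 <= f (x + sg *: e).
  have := MV 0 sg z0 sgsg sg0; rewrite scale0r addr0 subr0 c0sg.
  by have := ler_norm (- f x); rewrite normrN; lra.
have [|||s] := @IVT _ (fun s => f (x + s *: e)) (- sg) sg 0.
- by rewrite ge0_cp.
- apply: derivable_within_continuous => s; rewrite in_itv /= -ler_norml => /dg.
  by move=> h; case: h.
- by rewrite ge_min lo le_max hi orbT.
rewrite in_itv /= -ler_norml => ssg fs; exists s; split=> //.
exact: seg.
Qed.

(** Homogeneity in y reduces the claim to |y| = 1. The annulus 1/2 <= |y| <= 2 then leaves room for
    the tangent vector replacing y and keeps away from the zero section, where [S] is not assumed
    Lipschitz; compactness provides uniform constants there. *)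
Lemma key_estimate : exists r C : R, [/\ 0 < r, 0 <= C,
  (forall x, `|x0 - x| <= r -> A x) &
  forall x y, `|x0 - x| <= r -> `|S (x, y)| <= C * `|y| ^+ 2 /\
    hess S x y <= C * (`|f x| * `|y| ^+ 2 + `|d1 x y| * `|y|)].
Proof.
have near1 (v w : R) : 1 - v <= w -> v - 1 <= w -> w <= 2^-1 -> 2^-1 <= v <= 2.
  by move=> *; apply/andP; split; lra.
have le_double (v w z : R) : w <= 0 -> v - w <= z -> 0 <= z -> v <= z + z by lra.
have [r0 [r [c0 [r0p /andP[rp rr0] c0p H0 Hproj]]]] := project_point.
pose K : set (vec * vec) :=
  [set x | `|x0 - x| <= r0] `*` [set y | 2^-1 <= `|y| <= 2].
have cK : compact K.
  apply: compact_setM; first exact: rV_closed_ball_compact.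
  apply: bounded_closed_compact.
  - exists 2; split=> [|M ltM y /= /andP[_ y2]]; first exact: num_real.
    by rewrite (le_trans y2) // ltW.
  - have -> : [set y : vec | 2^-1 <= `|y| <= 2] =
        (fun y : vec => `|y|) @^-1` `[2^-1, 2]%classic.
      by apply/seteqP; split=> y /=; rewrite in_itv.
    by apply: closed_comp (interval_closed _ _) => // y _; exact: norm_continuous.
have neq0 (y : vec) : 2^-1 <= `|y| -> y <> 0.
  by move=> h y0; move: h; rewrite y0 normr0 leNgt invr_gt0 ltr0n.
have KA z : K z -> A z.1 /\ z.2 <> 0.
  by move=> [/= /H0[Az _] /andP[/neq0 z0 _]].
have [L1 [L10 H1b H1]] := llip_compact cK (fun z Kz => llip_hess (KA z Kz).1 (KA z Kz).2).
have [L2 [L20 _ H2]] := llip_compact cK (fun z Kz => llip_d1 (KA z Kz).1).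
have [L3 H3] : exists L3 : 'I_n -> R, forall i, 0 <= L3 i /\
    forall z, K z -> `|S z 0 i| <= L3 i.
  apply: (@fin_all_exists _ (fun=> R) (fun i l => 0 <= l /\
    forall z, K z -> `|S z 0 i| <= l)) => i.
  have [l [l0 Hl _]] := llip_compact cK (fun z Kz => S_llip i (KA z Kz).1 (KA z Kz).2).
  by exists l.
(* The displacement of the point is at most eta |f x|, that of the vector at most eta |d1 x1 y|.
   With |d1 x1 y| <= (1 + L2 eta) q, where q = |f x| + |d1 x y|, both are at most C1 q. *)
pose eta := `|e| / c0.
have eta0 : 0 <= eta by rewrite divr_ge0 // ltW.
pose C1 := eta * (1 + L2 * eta) + eta.
have C10 : 0 <= C1 by rewrite addr_ge0 // mulr_ge0 // addr_ge0 // mulr_ge0.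
pose C := 2 * L1 * C1 + \sum_i L3 i.
have C30 : 0 <= \sum_i L3 i by apply: sumr_ge0 => i _; case: (H3 i).
have C20 : 0 <= 2 * L1 * C1 by rewrite !mulr_ge0.
have unit_case x y : `|x0 - x| <= r -> `|y| = 1 -> `|S (x, y)| <= C /\
    hess S x y <= 2 * L1 * C1 * (`|f x| + `|d1 x y|).
  move=> xr y1.
  have Kxy y' : 2^-1 <= `|y'| <= 2 -> K (x, y').
    by move=> y'K; split=> //=; exact: le_trans rr0.
  have Ky : 2^-1 <= `|y| <= 2.
    by rewrite y1 invf_le1 ?ler1n.
  split.
    rewrite -[leLHS]add0r lerD //; apply: mx_norm_le => // i.
    have [_ h] := H3 i; apply: (le_trans (h _ (Kxy _ Ky))).
    by rewrite (bigD1 i) //= lerDl sumr_ge0 // => j _; case: (H3 j).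
  set q := `|f x| + `|d1 x y|.
  have q0 : 0 <= q by rewrite addr_ge0.
  have [s [ssg fs xs]] := Hproj x xr.
  pose x1 := x + s *: e.
  (* Subtracting this multiple of [e] makes the vector tangent to the level set at the projected
     point [x1]. *)
  pose y1' := y - (d1 x1 y / d1 x1 e) *: e.
  have [Ax1 dx1] := H0 _ xs.
  have dx1p : 0 < d1 x1 e by exact: lt_le_trans dx1.
  have dy1 : d1 x1 y1' = 0.
    by rewrite d1B d1Z divfK ?subrr // gt_eqF.
  have xx1 : `|x - x1| <= eta * `|f x|.
    rewrite /x1 opprD addNKr normrN normrZ.
    have -> : eta * `|f x| = `|f x| / c0 * `|e| by rewrite /eta; ring.
    by rewrite ler_wpM2r.
  have Kx1 y' : 2^-1 <= `|y'| <= 2 -> K (x1, y') by move=> y'K; split.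
  have dd : `|d1 x1 y| <= (1 + L2 * eta) * q.
    have : `|d1 x1 y - d1 x y| <= L2 * `|(x1, y) - (x, y)|.
      exact: (H2 (x1, y) (x, y) (Kx1 _ Ky) (Kxy _ Ky)).
    rewrite [`|(x1, y) - _|]prod_normE /= subrr normr0 max_l // distrC => h.
    have h2 : `|d1 x1 y| <= `|d1 x y| + `|d1 x y - d1 x1 y|.
      by rewrite distrC -lerBlDl lerB_dist.
    apply: (le_trans h2); rewrite distrC mulrDl mul1r lerD //.
      by rewrite /q lerDr.
    rewrite distrC; apply: (le_trans h); rewrite -mulrA ler_wpM2l // distrC.
    by apply: (le_trans xx1); rewrite ler_wpM2l // /q lerDl.
  have yy1 : `|y - y1'| <= eta * ((1 + L2 * eta) * q).
    rewrite /y1' opprB addrCA subrr addr0 normrZ normrM normfV (gtr0_norm dx1p).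
    have -> : eta * ((1 + L2 * eta) * q) = (1 + L2 * eta) * q / c0 * `|e|.
      by rewrite /eta; ring.
    rewrite ler_wpM2r // ler_pM // ?invr_ge0 ?(ltW dx1p) //.
    by rewrite lef_pV2.
  have cx : `|x - x1| <= C1 * q.
    apply: (le_trans xx1); rewrite /C1 mulrDl ler_wpDl //.
      by apply: mulr_ge0 => //; apply: mulr_ge0 => //; apply: addr_ge0 => //; exact: mulr_ge0.
    by rewrite ler_wpM2l // /q lerDl.
  have cy : `|y - y1'| <= C1 * q.
    apply: (le_trans yy1).
    have -> : C1 * q = eta * ((1 + L2 * eta) * q) + eta * q by rewrite /C1; ring.
    by rewrite lerDl mulr_ge0.
  (* If C1 q > 1/2 the corrected vector may leave the annulus, but then [L1], which bounds |hess|,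
     is itself below 2 L1 C1 q. This is the origin of the factor 2. *)
  have [qs|qb] := leP (C1 * q) 2^-1; last first.
    apply: (@le_trans _ _ L1).
      by apply: (le_trans (ler_norm _)); exact: (H1b (x, y) (Kxy _ Ky)).
    have := ler_wpM2l (mulr_ge0 (ler0n R 2) L10) (ltW qb).
    by rewrite mulrAC divff ?mul1r // !mulrA.
  have y1K : 2^-1 <= `|y1'| <= 2.
    apply: near1 (le_trans cy qs); first by rewrite -y1 lerB_dist.
    by rewrite -y1 distrC lerB_dist.
  have cv : hess S x1 y1' <= 0 by apply: convex => //; apply: neq0; case/andP: y1K.
  have := H1 (x, y) (x1, y1') (Kxy _ Ky) (Kx1 _ y1K).
  rewrite [`|(x, y) - _|]prod_normE /= => h.
  have h2 : hess S x y - hess S x1 y1' <= L1 * (C1 * q).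
    apply: (le_trans (ler_norm _)); apply: (le_trans h).
    by rewrite ler_wpM2l // ge_max cx cy.
  have -> : 2 * L1 * C1 * q = L1 * (C1 * q) + L1 * (C1 * q) by ring.
  by apply: le_double cv h2 _; rewrite !mulr_ge0.
exists r, C; split=> //.
- by rewrite addr_ge0.
- by move=> x xr; have [] := H0 x (le_trans xr rr0).
move=> x y xr; have Ax : A x by have [] := H0 x (le_trans xr rr0).
(* The zero vector cannot be normalized; there [S0] makes the spray and the Hessian vanish. *)
have [->|y0] := eqVneq y 0.
  rewrite S0 // normr0 expr0n /= !mulr0; split=> //.
  rewrite addr0 /hess S0 // -[X in d2 x X](scale0r (0 : vec)) d2Z.
  by rewrite -[X in d1 x X](scale0r (0 : vec)) d1Z expr0n /= !mul0r subrr !mulr0.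
have ny : 0 < `|y| by rewrite normr_gt0.
pose yh := `|y|^-1 *: y.
have yh1 : `|yh| = 1 by rewrite normrZ normfV normr_id mulVf // normr_eq0.
have yh0 : yh <> 0 by move=> h; move: yh1; rewrite h normr0 => /esym/eqP; rewrite oner_eq0.
have yE : y = `|y| *: yh by rewrite scalerA divff ?scale1r // normr_eq0.
have [hS hH] := unit_case x yh xr yh1.
have y2 : 0 <= `|y| ^+ 2 by rewrite exprn_ge0.
split.
  rewrite {1}yE S_homog // normrZ ger0_norm // mulrC.
  by rewrite ler_wpM2r.
rewrite {1}yE hessZ // [X in `|d1 x X|]yE d1Z normrM normr_id.
apply: (@le_trans _ _ (`|y| ^+ 2 * (2 * L1 * C1 * (`|f x| + `|d1 x yh|)))).
  by rewrite ler_wpM2l.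
have -> : C * (`|f x| * `|y| ^+ 2 + `|y| * `|d1 x yh| * `|y|) =
  `|y| ^+ 2 * (C * (`|f x| + `|d1 x yh|)) by ring.
by rewrite ler_wpM2l // ler_wpM2r ?addr_ge0 // /C lerDl.
Qed.

End Projection.
End KeyEstimate.

(** * Local equations of a hypersurface *)

Section LevelSets.
Context {R : realType} {n : nat}.
Local Notation vec := 'rV[R]_n.

Lemma locally_lipschitz_llip {E W : normedModType R} (A : set E) (h : E -> W) x :
  open A -> A x -> locally_lipschitz A h -> llip h x.
Proof.
move=> oA Ax /(_ x Ax)[B nB].
rewrite /lipschitz_on => H; near (pinfty_nbhs R) => M.
exists M, (A `&` B); split.
- by near: M; apply: nbhs_pinfty_ge; exact: num_real.
- by apply: filterI => //; exact: open_nbhs_nbhs.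
- move=> z w ABz ABw.
  have /(_ (z, w)) : M.-lipschitz_on h (globally ((A `&` B) `*` (A `&` B))).
    by near: M.
  by apply.
Unshelve. all: by end_near. Qed.

Lemma rV_basis (v : vec) : v = \sum_i v 0 i *: delta_mx 0 i.
Proof. exact: row_sum_delta. Qed.

(** The class provides each directional derivative separately; linearity in the direction comes from
    the continuity of the partial derivatives. *)
Lemma Ck1_loc1_derive (A : set vec) (f : vec -> R) x :
  open A -> A x -> Ck1_loc 1 A f ->
  llip f x /\ forall v, is_derive x v f (\sum_i v 0 i * 'D_(delta_mx 0 i) f x).
Proof.
move=> oA Ax Cf.
have nA : \forall z \near x, A z by exact: open_nbhs_nbhs.
have dA i : \forall z \near x, derivable f z (delta_mx 0 i) /\
    {for z, continuous ('D_(delta_mx 0 i) f)}.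
  apply: filterS nA => z Az; have [df lf] := Cf (delta_mx 0 i).
  split; first exact: df.
  exact/llip_continuous/(locally_lipschitz_llip oA Az).
split.
  apply: (@llip_derive _ _ _ (fun i => delta_mx 0 i) (fun i v => v 0 i)) => //.
  - exact: rV_basis.
  - by move=> i v; exact: coord_le.
move=> v; rewrite {1}(rV_basis v); apply: is_derive_sumv => i.
  by apply: filterS (dA i) => z [].
by have [] := nbhs_singleton (dA i).
Qed.

Lemma Ck1_loc2_C21 (A : set vec) (f : vec -> R) :
  open A -> Ck1_loc 2 A f ->
  C21 A f (fun i => 'D_(delta_mx 0 i) f)
    (fun i j => 'D_(delta_mx 0 j) ('D_(delta_mx 0 i) f)).
Proof.
move=> oA Cf.
have D2 i x (Ax : A x) : llip ('D_(delta_mx 0 i) f) x /\ forall v,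
    is_derive x v ('D_(delta_mx 0 i) f)
      (\sum_j v 0 j * 'D_(delta_mx 0 j) ('D_(delta_mx 0 i) f) x).
  by apply: (Ck1_loc1_derive oA) => //; case: (Cf (delta_mx 0 i)).
have Df x i : A x -> \forall z \near x, derivable f z (delta_mx 0 i) /\
    {for z, continuous ('D_(delta_mx 0 i) f)}.
  move=> Ax; apply: filterS (open_nbhs_nbhs (conj oA Ax)) => z Az; split.
    by have [+ _] := Cf (delta_mx 0 i); apply.
  by apply: llip_continuous; case: (D2 i z Az).
split=> //.
- move=> x v Ax; rewrite {1}(rV_basis v); apply: is_derive_sumv => i.
    by apply: filterS (Df x i Ax) => z [].
  by have [] := nbhs_singleton (Df x i Ax).
- by move=> i x v Ax; case: (D2 i x Ax).
- move=> x Ax; apply: (@llip_derive _ _ _ (fun i => delta_mx 0 i) (fun i v => v 0 i)) => //.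
  + exact: rV_basis.
  + by move=> i v; exact: coord_le.
  + by move=> i; exact: Df.
- by move=> i x Ax; case: (D2 i x Ax).
- move=> i j x Ax; have [_ h] := Cf (delta_mx 0 i).
  by have [_ h2] := h (delta_mx 0 j); exact: (locally_lipschitz_llip oA Ax).
Qed.

Lemma C21_sub (A A' : set vec) f a b :
  open A' -> A' `<=` A -> C21 A f a b -> C21 A' f a b.
Proof.
move=> oA' sub [oA h1 h2 h3 h4 h5]; split=> // *;
  [exact/h1/sub|exact/h2/sub|exact/h3/sub|exact/h4/sub|exact/h5/sub].
Qed.

Lemma is_derive_coord {E : normedModType R} (u : E -> vec) (x v : E) w i :
  is_derive x v u w -> is_derive x v (fun s => u s 0 i) (w 0 i).
Proof.
move=> [du <-]; apply: DeriveDef; first by move/derivable_mxP : du.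
by rewrite derive_mx // mxE.
Qed.

Lemma is_derive_sum_fun {E : normedModType R} (h : 'I_n -> E -> R) (x v : E) dh :
  (forall i, is_derive x v (h i) (dh i)) ->
  is_derive x v (fun s => \sum_i h i s) (\sum_i dh i).
Proof.
move=> H; have -> : (fun s => \sum_i h i s) = \sum_i h i.
  by apply/funext => s; rewrite fct_sumE.
exact: is_derive_sum.
Qed.

Section Curve.
Variables (A : set vec) (f : vec -> R) (a : 'I_n -> vec -> R)
  (b : 'I_n -> 'I_n -> vec -> R).
Hypothesis fC : C21 A f a b.

Lemma C21_curve1 (u : R -> vec) t v : A (u t) -> is_derive t 1 u v ->
  is_derive t 1 (f \o u) (d1 a (u t) v).
Proof.
move=> Au du; apply: (is_derive_curve (C21_llip fC Au) du).
exact: (C21_derive fC v Au).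
Qed.

Lemma C21_d1 (x v w : vec) : A x ->
  is_derive x v (fun z => d1 a z w) (\sum_i w 0 i * \sum_j v 0 j * b i j x).
Proof.
move=> Ax; apply: is_derive_sum_fun => i.
have := is_deriveZ (w 0 i) (C21_derive2 fC i v Ax); exact.
Qed.

Lemma C21_curve2 (u w : R -> vec) t w' : A (u t) -> is_derive t 1 u (w t) ->
  is_derive t 1 w w' ->
  is_derive t 1 (fun s => d1 a (u s) (w s)) (d1 a (u t) w' + d2 b (u t) (w t)).
Proof.
move=> Au du dw.
rewrite /d1 /d2 -big_split /=; apply: is_derive_sum_fun => i.
have h1 := is_derive_coord i dw.
have h2 : is_derive t 1 (a i \o u) (\sum_j w t 0 j * b i j (u t)).
  apply: (is_derive_curve (C21_llip1 fC i Au) du).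
  exact: (C21_derive2 fC i (w t) Au).
have h3 := is_deriveM h1 h2.
apply: (is_derive_eq h3).
by rewrite /GRing.scale /= [LHS]addrC [X in X + _ = _]mulrC.
Qed.

(** Projecting z to the zero level along e costs O(|f z|), so the Lipschitz function G satisfies |G|
    <= C |f| near x. Where f vanishes to first order in the direction y, so does G. *)
Lemma level_derive0 (x e y : vec) (G : vec -> R) l :
  A x -> f x = 0 -> 0 < d1 a x e -> llip G x ->
  (\forall z \near x, f z = 0 -> G z = 0) ->
  is_derive x y G l -> d1 a x y = 0 -> l = 0.
Proof.
move=> Ax fx0 de [L [B [L0 nB HL]]] nG dG dy0.
have [r0 [r [c0 [r0p /andP[rp _] c0p _ Hproj]]]] := project_point fC Ax fx0 de.
have df := C21_derive fC y Ax; rewrite -/(d1 a x y) dy0 in df.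
have Gx : G x = 0 by exact: (nbhs_singleton nG).
have [d /= dp Hd] : exists2 d : R, 0 < d & forall z, `|x - z| < d ->
    B z /\ (f z = 0 -> G z = 0).
  have /nbhs_ballP[d /= dp Hd] : \forall z \near x, B z /\ (f z = 0 -> G z = 0).
    exact: filterI.
  by exists d => // z xz; apply: Hd; rewrite -ball_normE.
have e1 : 0 < `|e| + 1 by rewrite ltr_wpDl.
(* The Lipschitz constant of G times the displacement per unit of |f z|; the last summand makes [C]
   positive. *)
pose C := L * (`|e| + 1) / c0 + 1.
have C0 : 0 < C by rewrite ltr_wpDl // divr_ge0 ?(ltW c0p) // mulr_ge0 // ltW.
have GC : \forall z \near x, `|G z| <= C * `|f z|.
  near=> z.
  have xzr : `|x - z| <= r.
    by near: z; apply: cvgr_dist_le; [exact: cvg_id|].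
  have xzd : `|x - z| < d / 2.
    by near: z; apply: cvgr_dist_lt; [exact: cvg_id|exact: divr_gt0].
  have fz : `|f z| <= d / 2 / (`|e| + 1) * c0.
    have : `|f x - f z| <= d / 2 / (`|e| + 1) * c0.
      near: z; apply: ((cvgrPdist_le _ _).1 (llip_continuous (C21_llip fC Ax))).
      by rewrite mulr_gt0 // !divr_gt0.
    by rewrite fx0 sub0r normrN.
  have [s [ssg fs _]] := Hproj z xzr.
  have se : `|s *: e| <= `|f z| / c0 * (`|e| + 1).
    by rewrite normrZ ler_pM // lerDl.
  have xs : `|x - (z + s *: e)| < d.
    rewrite opprD addrA (le_lt_trans (ler_normB _ _)) // (splitr d) ltr_leD //.
    by apply: (le_trans se); rewrite -ler_pdivlMr // ler_pdivrMr.
  have [Bz _] : B z /\ (f z = 0 -> G z = 0).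
    by apply: Hd; rewrite (lt_le_trans xzd) // ler_pdivrMr // ler_pMr // ler1n.
  have [Bs Gs] := Hd _ xs.
  have := HL _ _ Bz Bs; rewrite Gs // subr0 => h; apply: (le_trans h).
  rewrite opprD addNKr normrN; apply: (le_trans (ler_wpM2l L0 se)).
  have -> : L * (`|f z| / c0 * (`|e| + 1)) = L * (`|e| + 1) / c0 * `|f z| by ring.
  by rewrite ler_wpM2r // /C lerDl.
suff dG0 : is_derive x y G 0.
  by rewrite -(derive_val (is_derive := dG)) (derive_val (is_derive := dG0)).
apply: cvg_is_derive; apply/cvgrPdist_le => eps eps0.
have nGC : \forall h \near (0 : R)^', `|G (h *: y + x)| <= C * `|f (h *: y + x)|.
  by apply: nbhs_dnbhs; have c0' := @cvg_scale_shift _ _ y x; exact: (c0' _ GC).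
have nf : \forall h \near (0 : R)^', `|0 - h^-1 *: (f (h *: y + x) - f x)| <= eps / C.
  by apply: ((cvgrPdist_le _ _).1 (is_derive_cvg df)); exact: divr_gt0.
near=> h.
have h1 : `|G (h *: y + x)| <= C * `|f (h *: y + x)| by near: h.
have h2 : `|0 - h^-1 *: (f (h *: y + x) - f x)| <= eps / C by near: h.
move: h2; rewrite Gx fx0 !subr0 !sub0r !normrN !normrZ => h2.
apply: (le_trans (ler_wpM2l (normr_ge0 _) h1)).
by rewrite mulrCA mulrC -ler_pdivlMr.
Unshelve. all: by end_near. Qed.

End Curve.

(** * Comparison of two defining functions *)

Section ChangeOfDefiningFunction.
Variables (A : set vec) (f f' : vec -> R) (a a' : 'I_n -> vec -> R)
  (b b' : 'I_n -> 'I_n -> vec -> R).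
Hypotheses (fC : C21 A f a b) (fC' : C21 A f' a' b').
Hypothesis ff' : forall z, A z -> f z = 0 -> f' z = 0.

Lemma level_d1 (x e y : vec) : A x -> f x = 0 -> 0 < d1 a x e ->
  d1 a x y = 0 -> d1 a' x y = 0.
Proof.
move=> Ax fx0 de; apply: (@level_derive0 A f a b fC x e y f') => //.
- exact: (C21_llip fC').
- by apply: filterS (open_nbhs_nbhs (conj (C21_open fC) Ax)) => z; exact: ff'.
- exact: (C21_derive fC' y Ax).
Qed.

(** The vector y - (df y / df e) e lies in the kernel of df, hence in that of df'. In
    cross-multiplied form the relation says that a function vanishes on the level set, so
    [level_derive0] applies to it in turn. *)
Lemma level_d1_colinear (x e y : vec) : A x -> f x = 0 -> 0 < d1 a x e ->
  d1 a' x y * d1 a x e - d1 a' x e * d1 a x y = 0.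
Proof.
move=> Ax fx0 de.
have : d1 a' x (y - (d1 a x y / d1 a x e) *: e) = 0.
  apply: (level_d1 Ax fx0 de); rewrite d1B d1Z divfK ?subrr // gt_eqF //.
rewrite d1B d1Z => /eqP; rewrite subr_eq0 => /eqP ->.
by field; rewrite gt_eqF.
Qed.

(* Differentiating [level_d1_colinear] along the hypersurface compares the
   Hessians, without parametrizing curves of the hypersurface. *)
Lemma level_hess (S : vec * vec -> vec) (x e y : vec) :
  A x -> f x = 0 -> 0 < d1 a x e -> d1 a x y = 0 ->
  hess a' b' S x y * d1 a x e = d1 a' x e * hess a b S x y.
Proof.
move=> Ax fx0 de dy0; have dy0' := level_d1 Ax fx0 de dy0.
have lD (F : vec -> R) (c : 'I_n -> vec -> R) d v : C21 A F c d ->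
    llip (fun z => d1 c z v) x.
  move=> FC; apply: llip_sum => i _; apply: llipM; first exact: llip_cst.
  exact: (C21_llip1 FC i Ax).
have nA := open_nbhs_nbhs (conj (C21_open fC) Ax).
have npos : \forall z \near x, 0 < d1 a z e.
  exact: (cvgr_gt _ (llip_continuous (lD _ _ _ e fC))).
have : d2 b' x y * d1 a x e - d1 a' x e * d2 b x y = 0.
  apply: (@level_derive0 A f a b fC x e y
      (fun z => d1 a' z y * d1 a z e - d1 a' z e * d1 a z y)) => //.
  - apply: llipD; first by apply: llipM; [exact: lD fC'|exact: lD fC].
    by apply: llipN; apply: llipM; [exact: lD fC'|exact: lD fC].
  - near=> z => fz; apply: level_d1_colinear => //.
    + by near: z.
    + by near: z.
  (* Product rule along y: the derivatives of d1 a z e and d1 a' z e come multiplied by d1 a' x y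
     and d1 a x y, both zero. *)
  - have h1 := C21_d1 fC' y y Ax; have h2 := C21_d1 fC y e Ax.
    have h3 := C21_d1 fC' y e Ax; have h4 := C21_d1 fC y y Ax.
    apply: (is_derive_eq (is_deriveB (is_deriveM h1 h2) (is_deriveM h3 h4))).
    rewrite /GRing.scale /= dy0 dy0' !mul0r add0r addr0 /d2.
    by rewrite [X in X - _]mulrC.
move=> /eqP; rewrite subr_eq0 => /eqP E.
rewrite /hess mulrBl mulrBr E; congr (_ - _).
(* The spray enters the Hessian through the differential only, so this part follows from the
   proportionality of the differentials. *)
have /eqP := level_d1_colinear (S (x, y)) Ax fx0 de.
by rewrite subr_eq0 => /eqP.
Unshelve. all: by end_near. Qed.

End ChangeOfDefiningFunction.
End LevelSets.

(** * The spray of a Finsler metric *)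

Section Spray.
Context {R : realType} {n : nat} {M : topologicalType}.
Variables (m : smooth_structure R n M) (F : TMfun m) (c : chart_index m).
Hypothesis hF : finsler_metric F.
Local Notation vec := 'rV[R]_n.

Definition fiber_scale (l : R) (z : vec * vec) : vec * vec := (z.1, l *: z.2).

Lemma is_derive_fiber_scale (P : vec * vec -> R) l z v d :
  is_derive (fiber_scale l z) (fiber_scale l v) P d ->
  is_derive z v (P \o fiber_scale l) d.
Proof.
move=> H; have E (s : R) : fiber_scale l (z + s *: v) =
    fiber_scale l z + s *: fiber_scale l v.
  congr pair => /=; by rewrite scalerDr !scalerA mulrC.
have h0 : is_derive (fiber_scale l z + 0 *: fiber_scale l v) (fiber_scale l v) P d.
  by rewrite scale0r addr0.
have := (is_derive_line P _ _ 0 d).1 h0.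
have -> : (fun s : R => P (fiber_scale l z + s *: fiber_scale l v)) =
    (fun s => (P \o fiber_scale l) (z + s *: v)).
  by apply/funext => s /=; rewrite E.
by move=> /(is_derive_line _ z v 0 d).2; rewrite scale0r addr0.
Qed.

Lemma chart_img_open : open (chart_img c).
Proof. exact: img_open. Qed.

Lemma slit_open : open (slit_Tdom c).
Proof.
have -> : slit_Tdom c = (fst @^-1` (chart_img c)) `&` (snd @^-1` (~` [set 0])) by [].
apply: openI; apply: open_comp => //.
- by move=> z _; exact: cvg_fst.
- exact: chart_img_open.
- by move=> z _; exact: cvg_snd.
- apply: closed_openC; apply: accessible_closed_set1; apply: hausdorff_accessible.
  exact: norm_hausdorff.
Qed.

Lemma near_slit z : slit_Tdom c z -> \forall w \near z, slit_Tdom c w.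
Proof. by move=> h; apply: open_nbhs_nbhs; split=> //; exact: slit_open. Qed.

Lemma slit_scale l z : l != 0 -> slit_Tdom c z -> slit_Tdom c (fiber_scale l z).
Proof.
move=> l0 [z1 z2]; split=> //= /eqP; rewrite scaler_eq0 (negbTE l0) /= => /eqP.
exact: z2.
Qed.

Definition homogeneous k (P : vec * vec -> R) :=
  forall l z, 0 < l -> slit_Tdom c z -> P (fiber_scale l z) = l ^+ k * P z.

(** Near the scaled point, P is l^k times P composed with the inverse scaling; the chain rule
    applies to the latter. *)
Lemma homogeneous_derive k P l z v d : homogeneous k P -> 0 < l ->
  slit_Tdom c z -> is_derive z v P d ->
  is_derive (fiber_scale l z) (fiber_scale l v) P (l ^+ k * d).
Proof.
move=> hP l0 sz dP.
have l_n0 : l != 0 by rewrite gt_eqF.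
have sK w : fiber_scale l^-1 (fiber_scale l w) = w.
  by case: w => x y; rewrite /fiber_scale /= scalerA mulVf // scale1r.
have h0 : is_derive (fiber_scale l z) (fiber_scale l v) (P \o fiber_scale l^-1) d.
  by apply: is_derive_fiber_scale; rewrite !sK.
have := is_deriveZ (l ^+ k) h0.
apply: near_eq_is_derive.
apply: filterS (near_slit (slit_scale l_n0 sz)) => w sw.
have -> : w = fiber_scale l (fiber_scale l^-1 w).
  by case: w {sw} => x y; rewrite /fiber_scale /= scalerA mulfV // scale1r.
rewrite hP //.
  by rewrite /= sK.
by apply: slit_scale => //; rewrite invr_eq0.
Qed.

Local Notation L := (sqF F c).
Local Notation p j := ('D_(diry j) L).
Local Notation g i j := (fun z => fundamental_tensor F c z i j).

Lemma sqF_homogeneous : homogeneous 2 L.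
Proof.
move=> l [x y] l0 [/= xA _]; rewrite /sqF /fiber_scale /=.
by rewrite (F_homog hF) // exprMn.
Qed.

Lemma fiber_scale_diry l j : l *: diry j = fiber_scale l (diry j) :> vec * vec.
Proof. by congr pair; rewrite /= scaler0. Qed.

(** The scaling multiplies [diry j] by l, which costs one degree; it fixes [dirx j], so that
    position derivatives keep the degree. *)
Lemma homogeneous_derive_diry k P z j : homogeneous k.+1 P ->
  slit_Tdom c z -> derivable P z (diry j) -> forall l, 0 < l ->
  'D_(diry j) P (fiber_scale l z) = l ^+ k * 'D_(diry j) P z.
Proof.
move=> hP sz /derivableP dP l l0.
have := homogeneous_derive hP l0 sz dP.
rewrite -fiber_scale_diry => /(is_deriveZv l^-1).
rewrite scalerA mulVf ?scale1r ?gt_eqF // exprS -mulrA mulKf ?gt_eqF //.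
by move=> [_ ->].
Qed.

Lemma homogeneous_derive_dirx k P z j : homogeneous k P ->
  slit_Tdom c z -> derivable P z (dirx j) -> forall l, 0 < l ->
  'D_(dirx j) P (fiber_scale l z) = l ^+ k * 'D_(dirx j) P z.
Proof.
move=> hP sz /derivableP dP l l0.
have := homogeneous_derive hP l0 sz dP.
have -> : fiber_scale l (dirx j) = dirx j by rewrite /fiber_scale /= scaler0.
by move=> [_ ->].
Qed.

Lemma vderiv_homogeneous j : homogeneous 1 (p j).
Proof.
move=> l z l0 sz; apply: (homogeneous_derive_diry sqF_homogeneous) => //.
exact: F_derivable1.
Qed.

Lemma fundamental_tensorE (G : TMfun m) i j z :
  'D_(diry i) (fun w => 'D_(diry j) (sqF G c) w) z =
  2 * fundamental_tensor G c z i j.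
Proof. by rewrite mxE mulrA divff ?mul1r // pnatr_eq0. Qed.

Lemma g_fiber_scale i j l z : 0 < l -> slit_Tdom c z ->
  fundamental_tensor F c (fiber_scale l z) i j = fundamental_tensor F c z i j.
Proof.
move=> l0 sz; have dp : derivable (p j) z (diry i) by exact: F_derivable2.
have h := etrans (homogeneous_derive_diry (vderiv_homogeneous j) sz dp l0) (mul1r _).
apply: (@mulfI _ (2 : R)); first by rewrite pnatr_eq0.
exact (etrans (esym (fundamental_tensorE F i j _))
  (etrans h (fundamental_tensorE F i j _))).
Qed.

Lemma vertical_basis (y : vec) : (0, y) = \sum_i y 0 i *: diry i :> vec * vec.
Proof.
have -> : \sum_i y 0 i *: diry i = \sum_i (0, y 0 i *: delta_mx 0 i) :> vec * vec.
  by apply: eq_bigr => i _; congr pair; rewrite scaler0.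
rewrite {1}(rV_basis y); elim/big_rec2: _ => // i _ v _ <-.
by congr pair; rewrite /= addr0.
Qed.

Lemma horizontal_basis (x : vec) : (x, 0) = \sum_i x 0 i *: dirx i :> vec * vec.
Proof.
have -> : \sum_i x 0 i *: dirx i = \sum_i (x 0 i *: delta_mx 0 i, 0) :> vec * vec.
  by apply: eq_bigr => i _; congr pair; rewrite scaler0.
rewrite {1}(rV_basis x); elim/big_rec2: _ => // i _ v _ <-.
by congr pair; rewrite /= addr0.
Qed.

Lemma Ck1_loc1_llip_pair (A : set (vec * vec)) (f : vec * vec -> R) z :
  open A -> A z -> Ck1_loc 1 A f -> llip f z.
Proof.
move=> oA Az Cf.
apply: (@llip_derive _ _ ('I_n + 'I_n)%type
  (fun i => match i with inl k => dirx k | inr k => diry k end)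
  (fun i v => match i with inl k => v.1 0 k | inr k => v.2 0 k end)).
- move=> [x y]; rewrite big_sumType /= -horizontal_basis -vertical_basis.
  by congr pair; rewrite /= ?addr0 ?add0r.
- move=> [k|k] v; apply: (le_trans (coord_le _ _)); rewrite [leRHS]prod_normE /=.
    by rewrite le_max lexx.
  by rewrite le_max lexx orbT.
- move=> i; apply: filterS (open_nbhs_nbhs (conj oA Az)) => w Aw.
  set e := (X in derivable _ _ X); have [df lf] := Cf e.
  split; first exact: df.
  exact/llip_continuous/(locally_lipschitz_llip oA Aw).
Qed.

Lemma g_llip i j z : slit_Tdom c z -> llip (g i j) z.
Proof.
by move=> sz; apply: (Ck1_loc1_llip_pair slit_open sz); exact: g_C11.
Qed.

Lemma g_dirx_llip i j k z : slit_Tdom c z -> llip ('D_(dirx k) (g i j)) z.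
Proof.
move=> sz; have [_] := g_C11 hF c i j (dirx k).
exact: locally_lipschitz_llip slit_open sz.
Qed.

Lemma g_dirx_derivable i j k z : slit_Tdom c z -> derivable (g i j) z (dirx k).
Proof. by have [+ _] := g_C11 hF c i j (dirx k); exact. Qed.

(** The derivative along (0, y) is computed twice: as a combination of the vertical partial
    derivatives, and as the derivative of (1 + s)^k P z at s = 0. *)
Lemma euler k (P : vec * vec -> R) z : homogeneous k P -> slit_Tdom c z ->
  (forall j w, slit_Tdom c w -> derivable P w (diry j)) ->
  (forall j, {for z, continuous ('D_(diry j) P)}) ->
  \sum_j z.2 0 j * 'D_(diry j) P z = k%:R * P z.
Proof.
move=> hP sz dP cP.
have h1 : is_derive z (0, z.2) P (\sum_j z.2 0 j * 'D_(diry j) P z).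
  rewrite vertical_basis; apply: is_derive_sumv => // j.
  by apply: filterS (near_slit sz) => w; exact: dP.
have h2 : is_derive (0 : R) 1 (fun s : R => (1 + s) ^+ k * P z) (k%:R * P z).
  have h : is_derive (0 : R) 1 (fun s : R => (1 + s) ^+ k) (k%:R).
    have h1' : is_derive (0 : R) 1 (fun s : R => 1 + s) 1.
      exact: (is_derive_eq (is_deriveD (is_derive_cst (1 : R) (0 : R) 1)
        (is_derive_id (0 : R) 1)) (add0r 1)).
    have -> : (fun s : R => (1 + s) ^+ k) = (fun s : R => 1 + s) ^+ k.
      by apply/funext => s; rewrite exprfctE.
    apply: (is_derive_eq (is_deriveX k h1')).
    by rewrite addr0 expr1n /GRing.scale /= !mulr1.
  have -> : (fun s : R => (1 + s) ^+ k * P z) = (P z) *: (fun s : R => (1 + s) ^+ k).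
    by apply/funext => s; rewrite mulrC.
  by rewrite mulrC; exact: is_deriveZ.
have h3 : is_derive (z + 0 *: (0, z.2)) (0, z.2) P (k%:R * P z).
  apply/is_derive_line; apply: near_eq_is_derive h2.
  near=> s.
  have -> : z + s *: (0, z.2) = fiber_scale (1 + s) z.
    by congr pair; rewrite /= ?scaler0 ?addr0 // scalerDl scale1r.
  rewrite hP // -ltrBlDl sub0r.
  near: s; apply: lt_nbhsr; exact: ltrN10.
rewrite scale0r addr0 in h3.
by rewrite -(derive_val (is_derive := h1)) (derive_val (is_derive := h3)).
Unshelve. all: by end_near. Qed.

(** Euler's identity in degree 1; the partial derivatives of [p j] are entries of 2 g, whose
    regularity supplies the required continuity. *)
Lemma vderiv_euler j z : slit_Tdom c z ->
  p j z = 2 * \sum_i z.2 0 i * fundamental_tensor F c z i j.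
Proof.
move=> sz.
have cg i : {for z, continuous ('D_(diry i) (p j))}.
  have -> : 'D_(diry i) (p j) = (fun z => 2 * fundamental_tensor F c z i j).
    by apply/funext => w; rewrite fundamental_tensorE.
  by apply: llip_continuous; apply: llipM; [exact: llip_cst|exact: g_llip].
have dp i w : slit_Tdom c w -> derivable (p j) w (diry i).
  by move=> sw; exact: F_derivable2.
have := euler (vderiv_homogeneous j) sz dp cg; rewrite mul1r => <-.
by rewrite mulr_sumr; apply: eq_bigr => i _; rewrite fundamental_tensorE mulrCA.
Qed.

Lemma coord2_llip i (z : vec * vec) : llip (fun w : vec * vec => w.2 0 i) z.
Proof. exact: (llip_comp (llip_snd z) (llip_coord _ _)). Qed.

Lemma vderiv_llip j z : slit_Tdom c z -> llip (p j) z.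
Proof.
move=> sz; apply: (@llip_near_eq _ _ _
  (fun z : vec * vec => 2 * \sum_i z.2 0 i * fundamental_tensor F c z i j)).
  by apply: filterS (near_slit sz) => w sw; exact/esym/vderiv_euler.
apply: llipM; first exact: llip_cst.
apply: llip_sum => i _; apply: llipM; [exact: coord2_llip|exact: g_llip].
Qed.

(** Euler's identity in degree 2. The continuity of the [p j] that it requires comes from
    [vderiv_euler], hence the order of the two identities. *)
Lemma sqF_euler z : slit_Tdom c z ->
  L z = \sum_i z.2 0 i * \sum_j z.2 0 j * fundamental_tensor F c z j i.
Proof.
move=> sz.
have cp j : {for z, continuous (p j)} by exact/llip_continuous/vderiv_llip.
have dL j w : slit_Tdom c w -> derivable L w (diry j).
  by move=> sw; exact: F_derivable1.
have := euler sqF_homogeneous sz dL cp.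
under eq_bigr do rewrite vderiv_euler // mulrCA.
rewrite -mulr_sumr => /mulfI -> //.
Qed.

Lemma dirx_coord2 i k (z : vec * vec) :
  is_derive z (dirx k) (fun w : vec * vec => w.2 0 i : R) 0.
Proof.
have -> : z = z + 0 *: dirx k by rewrite scale0r addr0.
apply/is_derive_line.
have -> : (fun s : R => (z + s *: dirx k).2 0 i) = cst (z.2 0 i).
  by apply/funext => s; rewrite /= scaler0 addr0.
exact: is_derive_cst.
Qed.

(** The mixed derivative exists because [p j] is, near z, polynomial in y with coefficients g, which
    do have position derivatives. *)
Lemma vderiv_dirx j k z : slit_Tdom c z -> is_derive z (dirx k) (p j)
  (2 * \sum_i z.2 0 i * 'D_(dirx k) (g i j) z).
Proof.
move=> sz; apply: (@near_eq_is_derive _ _ _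
  (fun z : vec * vec => 2 * \sum_i z.2 0 i * fundamental_tensor F c z i j)).
  by apply: filterS (near_slit sz) => w sw; exact/esym/vderiv_euler.
have H i : is_derive z (dirx k) (fun z => z.2 0 i * fundamental_tensor F c z i j)
    (z.2 0 i * 'D_(dirx k) (g i j) z).
  have h1 := dirx_coord2 i k z.
  have h2 := derivableP (@g_dirx_derivable i j k z sz).
  apply: (is_derive_eq (is_deriveM h1 h2)).
  by rewrite /GRing.scale /= mulr0 addr0.
exact: (is_deriveZ 2 (is_derive_sum_fun H)).
Qed.

Lemma sqF_dirx k z : slit_Tdom c z -> is_derive z (dirx k) L
  (\sum_i z.2 0 i * \sum_j z.2 0 j * 'D_(dirx k) (g j i) z).
Proof.
move=> sz; apply: (@near_eq_is_derive _ _ _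
  (fun z : vec * vec => \sum_i z.2 0 i * \sum_j z.2 0 j * fundamental_tensor F c z j i)).
  by apply: filterS (near_slit sz) => w sw; exact/esym/sqF_euler.
apply: is_derive_sum_fun => i.
have H j : is_derive z (dirx k) (fun z => z.2 0 j * fundamental_tensor F c z j i)
    (z.2 0 j * 'D_(dirx k) (g j i) z).
  have h1 := dirx_coord2 j k z.
  have h2 := derivableP (@g_dirx_derivable j i k z sz).
  apply: (is_derive_eq (is_deriveM h1 h2)).
  by rewrite /GRing.scale /= mulr0 addr0.
apply: (is_derive_eq (is_deriveM (dirx_coord2 i k z) (is_derive_sum_fun H))).
by rewrite /GRing.scale /= mulr0 addr0.
Qed.

Lemma g_unit z : slit_Tdom c z -> fundamental_tensor F c z \in unitmx.
Proof.
move=> sz; rewrite unitmxE unitfE; apply/negP => /det0P[v v0 vg].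
have := g_posdef hF sz (_ : v <> 0); rewrite vg mul0mx mxE ltxx.
by move=> /(_ (elimN eqP v0)).
Qed.

(** After substitution of Euler's identities, only y, the inverse of g and first derivatives of g
    remain, and these are locally Lipschitz for g of class C^{1,1}. *)
Lemma spray_llip z i : slit_Tdom c z -> llip (fun w => spray F c w 0 i) z.
Proof.
move=> sz.
apply: (@llip_near_eq _ _ _ (fun w : vec * vec => \sum_j invmx (fundamental_tensor F c w) i j *
   (2^-1 * (\sum_k (2 * \sum_i w.2 0 i * 'D_(dirx k) (g i j) w) * w.2 0 k)
     - 2^-1 * (\sum_i w.2 0 i * \sum_k w.2 0 k * 'D_(dirx j) (g k i) w)))).
  apply: filterS (near_slit sz) => w sw; rewrite mxE; apply: eq_bigr => j _.
  rewrite (derive_val (is_derive := sqF_dirx j sw)).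
  congr (_ * (_ * _ - _)); apply: eq_bigr => k _.
  by rewrite (derive_val (is_derive := vderiv_dirx j k sw)).
apply: llip_sum => j _; apply: llipM.
  apply: llip_invmx => [k l|]; first exact: g_llip.
  by apply: filterS (near_slit sz) => w; exact: g_unit.
apply: llipD.
  apply: llipM; first exact: llip_cst.
  apply: llip_sum => k _; apply: llipM; last exact: coord2_llip.
  apply: llipM; first exact: llip_cst.
  apply: llip_sum => l _; apply: llipM; first exact: coord2_llip.
  exact: g_dirx_llip.
apply: llipN; apply: llipM; first exact: llip_cst.
apply: llip_sum => k _; apply: llipM; first exact: coord2_llip.
apply: llip_sum => l _; apply: llipM; first exact: coord2_llip.
exact: g_dirx_llip.
Qed.

Lemma sprayE z i : spray F c z 0 i =
  \sum_j invmx (fundamental_tensor F c z) i j *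
    (2^-1 * (\sum_k 'D_(dirx k) (p j) z * z.2 0 k) - 2^-1 * 'D_(dirx j) L z).
Proof. by rewrite mxE. Qed.

(** Degrees: 0 for the inverse of g, 1 for the mixed derivatives, which are multiplied by y, and 2
    for the position derivatives of F^2. *)
Lemma spray_homog x y l : chart_img c x -> y <> 0 -> 0 < l ->
  spray F c (x, l *: y) = l ^+ 2 *: spray F c (x, y).
Proof.
move=> xA y0 l0; have sz : slit_Tdom c (x, y) by [].
rewrite -[(x, l *: y)]/(fiber_scale l (x, y)).
have Eg : fundamental_tensor F c (fiber_scale l (x, y)) = fundamental_tensor F c (x, y).
  by apply/matrixP => i j; exact: g_fiber_scale.
have ED j : 'D_(dirx j) L (fiber_scale l (x, y)) = l ^+ 2 * 'D_(dirx j) L (x, y).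
  exact (homogeneous_derive_dirx sqF_homogeneous sz
    (ex_derive (is_derive := sqF_dirx j sz)) l0).
have EP j k : 'D_(dirx k) (p j) (fiber_scale l (x, y)) = l * 'D_(dirx k) (p j) (x, y).
  exact (homogeneous_derive_dirx (vderiv_homogeneous j) sz
    (ex_derive (is_derive := vderiv_dirx j k sz)) l0).
apply/rowP => i; rewrite sprayE [RHS]mxE sprayE mulr_sumr; apply: eq_bigr => j _.
rewrite [RHS]mulrCA Eg; congr (_ * _); rewrite [RHS]mulrBr; congr (_ - _).
  rewrite [RHS]mulrCA; congr (_ * _); rewrite mulr_sumr; apply: eq_bigr => k _.
  transitivity (l * 'D_(dirx k) (p j) (x, y) * (l * y 0 k)).
    by congr (_ * _); [exact: EP|rewrite mxE].
  by rewrite /=; move: (derive _ _ _) => d; ring.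
by rewrite [RHS]mulrCA; congr (_ * _); exact: ED.
Qed.

Lemma sqF_dirx0 x j : chart_img c x -> is_derive (x, 0) (dirx j) L 0.
Proof.
move=> xA.
have h0 : is_derive ((x, 0) + 0 *: dirx j) (dirx j) L 0.
  apply/is_derive_line.
  apply: (@near_eq_is_derive _ _ _ (cst (0 : R))).
  have nA : \forall s \near (0 : R), chart_img c (s *: delta_mx 0 j + x).
    have h := @cvg_scale_shift R _ (delta_mx 0 j) x.
    exact: (h _ (open_nbhs_nbhs (conj chart_img_open xA))).
  apply: filterS nA => s /=; rewrite addrC => sA.
  have -> : (x, 0) + s *: dirx j = (x + s *: delta_mx 0 j, 0).
    by congr pair; rewrite /= scaler0 addr0.
  have sT : Tdom c (x + s *: delta_mx 0 j, 0) by [].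
  by rewrite /sqF ((F_eq0 hF sT).2 erefl) expr0n.
by move: h0; rewrite scale0r addr0.
Qed.

Lemma spray0 x : chart_img c x -> spray F c (x, 0) = 0.
Proof.
move=> xA; apply/rowP => i; rewrite sprayE [RHS]mxE big1 // => j _.
rewrite (derive_val (is_derive := sqF_dirx0 j xA)).
rewrite big1 ?mulr0 ?subrr ?mulr0 // => k _.
by rewrite /= mxE mulr0.
Qed.

(** * The reversed metric *)

Local Notation refl := (fiber_scale (- 1)).

Lemma reflE (z : vec * vec) : refl z = (z.1, - z.2).
Proof. by rewrite /fiber_scale scaleN1r. Qed.

Lemma sqF_reversed : sqF (reversed F) c = L \o refl.
Proof. by apply/funext => z; rewrite /comp reflE. Qed.

Lemma refl_diry j : refl (diry j) = - 1 *: diry j :> vec * vec.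
Proof. by rewrite -fiber_scale_diry. Qed.

Lemma refl_dirx j : refl (dirx j) = dirx j :> vec * vec.
Proof. by rewrite /fiber_scale /= scaler0. Qed.

Lemma slit_refl z : slit_Tdom c z -> slit_Tdom c (refl z).
Proof. by apply: slit_scale; rewrite oppr_eq0 oner_eq0. Qed.

Lemma vderiv_reversed j z : slit_Tdom c z ->
  'D_(diry j) (sqF (reversed F) c) z = - p j (refl z).
Proof.
move=> sz; rewrite sqF_reversed.
have dL : is_derive (refl z) (diry j) L (p j (refl z)).
  by apply: derivableP; exact: (F_derivable1 hF (slit_refl sz)).
have h : is_derive (refl z) (refl (diry j)) L (- 1 * p j (refl z)).
  by rewrite refl_diry; exact: is_deriveZv.
by rewrite (derive_val (is_derive := is_derive_fiber_scale h)) mulN1r.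
Qed.

Lemma vderiv_reversed_derive j z v w d : slit_Tdom c z -> refl v = w ->
  is_derive (refl z) w (p j) d ->
  'D_v (fun z => 'D_(diry j) (sqF (reversed F) c) z) z = - d.
Proof.
move=> sz <- /is_derive_fiber_scale /(is_deriveN (f := _)) h.
have h' : is_derive z v (fun z => 'D_(diry j) (sqF (reversed F) c) z) (- d).
  apply: near_eq_is_derive h.
  by apply: filterS (near_slit sz) => y sy; rewrite vderiv_reversed.
by rewrite (derive_val (is_derive := h')).
Qed.

Lemma g_reversed z : slit_Tdom c z ->
  fundamental_tensor (reversed F) c z = fundamental_tensor F c (refl z).
Proof.
move=> sz; apply/matrixP => i j.
have dp : is_derive (refl z) (diry i) (p j) ('D_(diry i) (p j) (refl z)).
  by apply: derivableP; exact: (F_derivable2 hF (slit_refl sz)).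
have h := vderiv_reversed_derive sz (refl_diry i) (is_deriveZv (- 1) dp).
have E (d : R) : - (- 1 * d) = d by rewrite mulN1r opprK.
apply: (@mulfI _ (2 : R)); first by rewrite pnatr_eq0.
exact (etrans (esym (fundamental_tensorE (reversed F) i j _))
  (etrans h (etrans (E _) (fundamental_tensorE F i j _)))).
Qed.

Lemma sprayE_reversed z i : spray (reversed F) c z 0 i =
  \sum_j invmx (fundamental_tensor (reversed F) c z) i j *
    (2^-1 * (\sum_k 'D_(dirx k) (fun z => 'D_(diry j) (sqF (reversed F) c) z) z * z.2 0 k) -
     2^-1 * 'D_(dirx j) (sqF (reversed F) c) z).
Proof. by rewrite mxE. Qed.

(** Each velocity derivative and each factor y changes sign under y |-> -y. These signs come in
    pairs, both in the tensor and in the bracket of the spray. *)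
Lemma spray_reversed z : slit_Tdom c z ->
  spray (reversed F) c z = spray F c (z.1, - z.2).
Proof.
move=> sz; rewrite -reflE; have sr := slit_refl sz.
apply/rowP => i; rewrite sprayE_reversed sprayE g_reversed //.
apply: eq_bigr => j _; congr (_ * (_ * _ - _ * _)).
  apply: eq_bigr => k _.
  rewrite (vderiv_reversed_derive sz (refl_dirx k) (vderiv_dirx j k sr)).
  rewrite (derive_val (is_derive := vderiv_dirx j k sr)).
  by rewrite /fiber_scale /= mxE mulrA mulrN1.
have h : is_derive (refl z) (refl (dirx j)) L ('D_(dirx j) L (refl z)).
  by rewrite refl_dirx; apply: derivableP; exact: (ex_derive (is_derive := sqF_dirx j sr)).
by rewrite sqF_reversed (derive_val (is_derive := is_derive_fiber_scale h)).
Qed.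

Lemma spray0_reversed x : chart_img c x -> spray (reversed F) c (x, 0) = 0.
Proof.
move=> xA; apply/rowP => i; rewrite sprayE_reversed [RHS]mxE big1 // => j _.
have h : is_derive (refl (x, 0)) (refl (dirx j)) L 0.
  by rewrite refl_dirx reflE /= oppr0; exact: sqF_dirx0.
rewrite sqF_reversed (derive_val (is_derive := is_derive_fiber_scale h)).
rewrite big1 ?mulr0 ?subrr ?mulr0 // => k _.
by rewrite /= mxE mulr0.
Qed.

End Spray.

(** * Confinement of short geodesics *)

Lemma closed_left_limit {R : realType} {T : topologicalType} (D : set T) (h : R -> T) t :
  closed D -> {for t, continuous h} -> 0 < t ->
  (forall s, 0 <= s < t -> D (h s)) -> D (h t).
Proof.
move=> cD ch t0 H; apply: contrapT => nD.
have nh : \forall s \near t, ~ D (h s).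
  have nD' : nbhs (h t) (~` D) by apply: open_nbhs_nbhs; split=> //; exact: closed_openC.
  exact: (ch _ nD').
move: nh => /nbhs_ballP[d /= d0 Hd].
pose s := Num.max 0 (t - d / 2).
have st : s < t by rewrite gt_max t0 /= gtrBl divr_gt0.
have /Hd : ball t d s.
  rewrite -ball_normE /ball_ /= gtr0_norm ?subr_gt0 // ltrBlDr.
  rewrite -ltrBlDl lt_max; apply/orP; right.
  by rewrite ltrD2l ltrN2 ltr_pdivrMr // ltr_pMr // ltr1n.
by apply; apply: H; rewrite st le_max lexx.
Qed.

(** The norm is the maximum of the coordinates, so the mean value theorem coordinate by coordinate
    loses no constant. *)
Lemma norm_increment_le {R : realType} {n : nat} (w w' : R -> 'rV[R]_n) (t B : R) :
  0 <= t -> 0 <= B ->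
  (forall s : R, 0 <= s <= t -> is_derive s 1 w (w' s) /\ `|w' s| <= B) ->
  `|w t - w 0| <= B * t.
Proof.
move=> t0 B0 H; apply: mx_norm_le; first exact: mulr_ge0.
move=> i; have di (s : R) : 0 <= s <= t -> is_derive s 1 (fun s => w s 0 i) (w' s 0 i).
  by move=> /H[dw _]; exact: is_derive_coord.
have [||s] := @MVT_segment _ (fun s => w s 0 i) (fun s => w' s 0 i) 0 t t0.
- move=> s; rewrite in_itv /= => /andP[/ltW s0 /ltW st]; apply: di.
  by rewrite s0.
- apply: derivable_within_continuous => s; rewrite in_itv /= => /di.
  by move=> h; case: h.
rewrite in_itv /= => st E; rewrite !mxE E subr0 normrM (ger0_norm t0).
by rewrite ler_wpM2r // (le_trans (coord_le _ _)) //; case: (H s st).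
Qed.

Section Manifold.
Context {R : realType} {n : nat} {M : topologicalType}.
Variables (m : smooth_structure R n M) (c : chart_index m).
Local Notation vec := 'rV[R]_n.
Local Notation u_ gam := (chart c \o gam : R -> vec).

Lemma geodesic_is_derive (G : TMfun m) (a b : R) gam t : geodesic G a b gam ->
  a < t < b -> dom c (gam t) ->
  is_derive t 1 (u_ gam) (derive1 (u_ gam) t) /\
  is_derive t 1 (derive1 (u_ gam)) (- spray G c (u_ gam t, derive1 (u_ gam) t)).
Proof.
move=> geo tab dt; have [_ /(_ c dt)[du du' E]] := geo t tab.
split; first exact (DeriveDef du (esym (derive1E _ _))).
exact (DeriveDef du' (etrans (esym (derive1E _ _)) E)).
Qed.

Lemma derive_continuous (w : R -> vec) (t : R) w' :
  is_derive t 1 w w' -> {for t, continuous w}.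
Proof. by move=> [dw _]; apply/differentiable_continuous/derivable1_diffP. Qed.

(** [dom c] is only open, and a curve might leave it with bounded coordinates. The image of the
    compact ball is compact, hence closed in the Hausdorff space M, and it retains limit points. *)
Lemma chart_ball_closed (x0 : vec) (r : R) :
  (forall w, `|x0 - w| <= r -> chart_img c w) ->
  closed (chart_inv c @` [set w | `|x0 - w| <= r]).
Proof.
move=> sub; apply: compact_closed; first exact: mfd_hausdorff m.
apply: continuous_compact; last exact: rV_closed_ball_compact.
apply: continuous_in_subspaceT => w; rewrite inE => /sub wA.
by apply: (@chart_inv_continuous _ _ _ m c); rewrite inE.
Qed.

(** As long as the speed is at most 2 eps, the point moves by at most 2 eps < r and the velocity by
    at most 4 C eps^2 <= eps / 2, so the speed is in fact less than 2 eps. This strict gain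
    propagates the bounds forward, closedness passes them to limit times, and [segment_induction]
    concludes. *)
Lemma geodesic_confined (G : TMfun m) (x : M) (y : vec) (a b r C eps : R) gam :
  dom c x -> (forall w, `|chart c x - w| <= r -> chart_img c w) ->
  (forall w v, `|chart c x - w| <= r -> `|spray G c (w, v)| <= C * `|v| ^+ 2) ->
  0 <= C -> 0 < eps -> 2 * eps < r -> 8 * C * eps <= 1 ->
  geodesic_from G c x y a b gam -> 1 < b -> `|y| <= eps ->
  forall t, 0 <= t <= 1 -> [/\ dom c (gam t), `|chart c x - u_ gam t| <= r &
    `|derive1 (u_ gam) t| <= 2 * eps].
Proof.
move=> dx sub HS C0 e0 er Ce [/andP[a0 b0] geo g0 dy] b1 yeps.
set x0 := chart c x; set u := u_ gam; set u' := derive1 u.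
have tab t : 0 <= t <= 1 -> a < t < b.
  by move=> /andP[t0 t1]; rewrite (lt_le_trans a0 t0) (le_lt_trans t1 b1).
have u0 : u 0 = x0 by rewrite /u /= g0.
have u'0 : u' 0 = y by exact: dy.
have e20 : 0 <= 2 * eps by rewrite mulr_ge0 // ltW.
apply: segment_induction.
- split; first by rewrite g0.
  + by rewrite u0 subrr normr0 ltW // (le_lt_trans e20 er).
  + by rewrite u'0 (le_trans yeps) // ler_peMl ?ler1n // ltW.
- move=> t /andP[t0 t1] HP.
  have Hd s : 0 <= s <= t -> is_derive s 1 u (u' s) /\
      is_derive s 1 u' (- spray G c (u s, u' s)).
    move=> /[dup] /HP[ds _ _] /andP[s0 st]; apply: (geodesic_is_derive geo) => //.
    by apply: tab; rewrite s0 (le_trans st) // ltW.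
  have tt : 0 <= t <= t by rewrite t0 lexx.
  have [dut du't] := Hd t tt; have [dt _ _] := HP t tt.
  have B0 : 0 <= C * (2 * eps) ^+ 2 by apply: mulr_ge0 => //; exact: exprn_ge0.
  have HB (s : R) : 0 <= s <= t -> is_derive s 1 u' (- spray G c (u s, u' s)) /\
      `|- spray G c (u s, u' s)| <= C * (2 * eps) ^+ 2.
    move=> st; split; first by case: (Hd s st).
    have [_ xs vs] := HP s st; rewrite normrN (le_trans (HS _ _ xs)) //.
    by rewrite ler_wpM2l // lerXn2r ?nnegrE.
  have B1 : `|u' t - u' 0| <= (C * (2 * eps) ^+ 2) * t.
    exact (@norm_increment_le R n u' (fun s => - spray G c (u s, u' s)) t _ t0 B0 HB).
  have HB2 (s : R) : 0 <= s <= t -> is_derive s 1 u (u' s) /\ `|u' s| <= 2 * eps.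
    by move=> st; split; [case: (Hd s st)|case: (HP s st)].
  have B2 : `|u t - u 0| <= 2 * eps * t.
    exact (@norm_increment_le R n u u' t _ t0 e20 HB2).
  have B1' : `|u' t| < 2 * eps.
    have : C * (2 * eps) ^+ 2 * t <= eps / 2.
      apply: (@le_trans _ _ (C * (2 * eps) ^+ 2)).
        by rewrite ler_piMr ?(ltW t1) // mulr_ge0 // exprn_ge0.
      have -> : C * (2 * eps) ^+ 2 = 8 * C * eps * (eps / 2) by field.
      by rewrite ler_piMl // divr_ge0 // ltW.
    have : `|u' t| <= `|u' t - u' 0| + `|u' 0| by rewrite -lerBlDr lerB_dist.
    move: B1; rewrite u'0; move: yeps e0; clear; lra.
  have B2' : `|x0 - u t| < r.
    rewrite -u0 distrC (le_lt_trans B2) // (le_lt_trans _ er) //.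
    by rewrite ler_piMr // ltW.
  have : \forall s \near t, [/\ dom c (gam s), `|x0 - u s| <= r & `|u' s| <= 2 * eps].
    have n1 : \forall s \near t, dom c (gam s).
      have [cg _] := geo t (tab t (introT andP (conj t0 (ltW t1)))).
      exact: (cg _ (open_nbhs_nbhs (conj (dom_open c) dt))).
    have n2 : \forall s \near t, `|x0 - u s| < r.
      have cu : `|x0 - u s| @[s --> t] --> `|x0 - u t|.
        apply: cvg_norm; apply: cvgB; first exact: cvg_cst.
        exact: (derive_continuous dut).
      exact: (cvgr_lt _ cu).
    have n3 : \forall s \near t, `|u' s| < 2 * eps.
      have cu : `|u' s| @[s --> t] --> `|u' t|.
        by apply: cvg_norm; exact: (derive_continuous du't).
      exact: (cvgr_lt _ cu).
    near=> s; split; first by near: s.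
    + by apply: ltW; near: s.
    + by apply: ltW; near: s.
  move=> /nbhs_ballP[d /= d0 Hball]; exists d; first exact: d0.
  move=> s /andP[ts sd] _.
  apply: Hball; rewrite -ball_normE /ball_ /= distrC gtr0_norm ?subr_gt0 //.
  by rewrite ltrBlDl.
- move=> t /andP[t0 t1] HP.
  have t01 : 0 <= t <= 1 by rewrite ltW.
  have [cg _] := geo t (tab t t01).
  (* Coordinates mean nothing outside [dom c], so the limit is first taken in M, within a closed
     subset of [dom c]. *)
  have [w /= wr wE] : (chart_inv c @` [set w | `|x0 - w| <= r]) (gam t).
    apply: closed_left_limit cg t0 _; first exact: chart_ball_closed.
    move=> s /HP[ds xs _]; exists (u s) => //.
    by rewrite /u /= chartK // inE.
  have [z dz zw] := sub w wr.
  have zt : z = gam t by rewrite -wE -zw chartK // inE.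
  have dt : dom c (gam t) by rewrite -zt.
  have uw : u t = w by rewrite /u /= -zt.
  have [_ du't] := geodesic_is_derive geo (tab t t01) dt.
  split=> //; first by rewrite -/u uw.
  apply: (@closed_left_limit _ _ [set v | `|v| <= 2 * eps] u') t0 _.
  + have -> : [set v : vec | `|v| <= 2 * eps] = [set v | `|0 - v| <= 2 * eps].
      by apply/seteqP; split=> v /=; rewrite sub0r normrN.
    exact: closed_closed_ball_.
  + exact: (derive_continuous du't).
  + by move=> s /HP[].
Unshelve. all: by end_near. Qed.

End Manifold.

(** * Geodesics below the hypersurface *)

Section Local.
Context {R : realType} {n : nat} {M : topologicalType}.
Variables (m : smooth_structure R n M) (c : chart_index m).
Local Notation vec := 'rV[R]_n.
Local Notation img V := (chart c @` (V `&` dom c)).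
Local Notation loc phi := (phi \o chart_inv c : vec -> R).
Local Notation pd phi := (fun i => 'D_(delta_mx 0 i) (loc phi)).
Local Notation pd2 phi :=
  (fun i j => 'D_(delta_mx 0 j) ('D_(delta_mx 0 i) (loc phi))).

Lemma chart_invK z : dom c z -> chart_inv c (chart c z) = z.
Proof. by move=> dz; rewrite chartK // inE. Qed.

Lemma img_mem (V : set M) z : V z -> dom c z -> img V (chart c z).
Proof. by move=> Vz dz; exists z. Qed.

Lemma img_sub (V : set M) : img V `<=` chart_img c.
Proof. by move=> _ [z [_ dz] <-]; exists z. Qed.

Lemma img_chart_open (V : set M) : open V -> open (img V).
Proof.
move=> oV; rewrite openE => _ [z [Vz dz] <-].
have zc : chart_img c (chart c z) by exists z.
have n1 : \forall w \near chart c z, chart_img c w.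
  by apply: open_nbhs_nbhs; split=> //; exact: chart_img_open.
have n2 : \forall w \near chart c z, V (chart_inv c w).
  have ci : {for chart c z, continuous (chart_inv c)}.
    by apply: (@chart_inv_continuous _ _ _ m c); rewrite inE.
  by apply: (ci V); rewrite chart_invK //; exact: open_nbhs_nbhs.
apply: filterS (filterI n1 n2) => w [[z' dz' <-]].
by rewrite chart_invK // => Vz'; exists z'.
Qed.

Section DefiningFunction.
Variables (N V : set M) (phi : M -> R).
Hypothesis dphi : defining_function m N V phi.

Lemma defining_C21 : C21 (img V) (loc phi) (pd phi) (pd2 phi).
Proof.
by case: dphi => oV Cphi _ _; apply: Ck1_loc2_C21; [exact: img_chart_open|exact: Cphi].
Qed.

Lemma fdiff_d1 z y : V z -> dom c z -> fdiff phi c z y = d1 (pd phi) (chart c z) y.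
Proof.
move=> Vz dz.
exact: (derive_val (is_derive := C21_derive defining_C21 y (img_mem Vz dz))).
Qed.

Lemma defining_zero w : img V w -> loc phi w = 0 <-> N (chart_inv c w).
Proof.
case: dphi => _ _ zN _ [z [Vz dz] <-]; rewrite /= chart_invK //; exact: zN.
Qed.

End DefiningFunction.

Lemma defining_transverse (N V : set M) phi z : defining_function m N V phi ->
  V z -> N z -> dom c z -> exists e, 0 < d1 (pd phi) (chart c z) e.
Proof.
move=> dphi Vz Nz dz; case: (dphi) => _ _ _ /(_ z c (conj Vz Nz) dz)[y].
rewrite (fdiff_d1 dphi) // => /eqP; rewrite neq_lt => /orP[y0|y0]; last by exists y.
by exists (- y); rewrite d1N oppr_gt0.
Qed.

Lemma defining_pair (N V V' : set M) phi phi' :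
  defining_function m N V phi -> defining_function m N V' phi' ->
  [/\ C21 (img V `&` img V') (loc phi) (pd phi) (pd2 phi),
      C21 (img V `&` img V') (loc phi') (pd phi') (pd2 phi') &
      forall w, (img V `&` img V') w -> loc phi w = 0 -> loc phi' w = 0].
Proof.
move=> dphi dphi'.
have oVV : open (img V `&` img V').
  by apply: openI; apply: img_chart_open; [case: dphi|case: dphi'].
split.
- by apply: C21_sub oVV _ (defining_C21 dphi) => w [].
- by apply: C21_sub oVV _ (defining_C21 dphi') => w [].
- move=> w [Vw Vw'] /(defining_zero dphi Vw) Nw.
  exact/(defining_zero dphi' Vw').
Qed.

(** A vector is tangent as soon as some defining function has it in the kernel of its differential;
    [level_d1] carries this over to [phi]. *)
Lemma tangent_d1 (N V : set M) phi z y : defining_function m N V phi ->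
  V z -> N z -> dom c z ->
  tangent_space N c z y <-> d1 (pd phi) (chart c z) y = 0.
Proof.
move=> dphi Vz Nz dz; split=> [[V' [phi' [V'z dphi' H]]]|H]; last first.
  by exists V, phi; split=> //; rewrite (fdiff_d1 dphi).
have [fC fC' ff'] := defining_pair dphi' dphi.
have [e de] := defining_transverse dphi' V'z Nz dz.
apply: (level_d1 fC fC' ff' _ _ de).
- by split; apply: img_mem.
- by apply/(defining_zero dphi'); [exact: img_mem|rewrite chart_invK].
- by rewrite -(fdiff_d1 dphi').
Qed.

(** The chain rule is applied twice along any geodesic witnessing the Hessian, and the geodesic
    equation replaces the acceleration by minus the spray. *)
Lemma is_hessian_hess (F : TMfun m) (N V : set M) phi z y h :
  defining_function m N V phi -> V z -> dom c z -> is_hessian F phi c z y h ->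
  h = hess (pd phi) (pd2 phi) (spray F c) (chart c z) y.
Proof.
move=> dphi Vz dz [a [b [gam [[a0b geo g0 dy] ->]]]].
have fC := defining_C21 dphi.
set u := chart c \o gam; set u' := derive1 u.
have oV : open V by case: dphi.
have near0 : \forall t \near (0 : R), [/\ a < t < b, V (gam t) & dom c (gam t)].
  have cg : {for 0, continuous gam} by case: (geo 0 a0b).
  have n1 : \forall t \near (0 : R), a < t < b.
    case/andP: a0b => a0 b0; near=> t; apply/andP; split; near: t.
      exact: lt_nbhsr.
    exact: lt_nbhsl.
  have n2 : \forall t \near (0 : R), V (gam t).
    by apply: (cg V); rewrite g0; exact: open_nbhs_nbhs.
  have n3 : \forall t \near (0 : R), dom c (gam t).
    by apply: (cg (dom c)); rewrite g0; apply: open_nbhs_nbhs; split=> //; exact: dom_open.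
  by near=> t; split; near: t.
have Hd t : a < t < b -> V (gam t) -> dom c (gam t) ->
    [/\ img V (u t), is_derive t 1 u (u' t) &
        is_derive t 1 u' (- spray F c (u t, u' t))].
  move=> tab Vt dt; have [h1 h2] := geodesic_is_derive geo tab dt.
  by split=> //; exact: img_mem.
(* The first derivative is computed on a whole neighborhood of 0, since it is to be differentiated
   again. *)
have E : \forall t \near (0 : R), derive1 (phi \o gam) t = d1 (pd phi) (u t) (u' t).
  have nn := near_join near0.
  apply: filterS nn => t nt; have [tab Vt dt] := nbhs_singleton nt.
  have [At dut _] := Hd t tab Vt dt.
  rewrite derive1E.
  have h1 : is_derive t 1 (phi \o gam) (d1 (pd phi) (u t) (u' t)).
    apply: near_eq_is_derive (C21_curve1 fC At dut).
    by apply: filterS nt => s [_ _ ds]; rewrite /u /= chart_invK.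
  by rewrite (derive_val (is_derive := h1)).
have [tab Vt dt] := nbhs_singleton near0.
have [At dut du't] := Hd 0 tab Vt dt.
rewrite derive1E (near_eq_derive _ E).
rewrite (derive_val (is_derive := C21_curve2 fC At dut du't)) d1N /hess addrC.
by rewrite /u /= g0 /u' dy.
Unshelve. all: by end_near. Qed.

(** The metric enters only through properties of its spray, so that the statement serves both [F]
    and its reverse. *)
Lemma geodesic_below (G : TMfun m) (N V : set M) phi x e :
  defining_function m N V phi -> V x -> N x -> dom c x ->
  0 < d1 (pd phi) (chart c x) e ->
  (forall z i, img V z.1 -> z.2 <> 0 -> llip (fun w => spray G c w 0 i) z) ->
  (forall x y l, img V x -> y <> 0 -> 0 < l ->
     spray G c (x, l *: y) = l ^+ 2 *: spray G c (x, y)) ->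
  (forall x, img V x -> spray G c (x, 0) = 0) ->
  (forall x y, img V x -> loc phi x = 0 -> d1 (pd phi) x y = 0 -> y <> 0 ->
     hess (pd phi) (pd2 phi) (spray G c) x y <= 0) ->
  exists2 eps : R, 0 < eps & forall y a b gam, `|y| <= eps ->
    d1 (pd phi) (chart c x) y = 0 -> geodesic_from G c x y a b gam -> 1 < b ->
    phi (gam 1) <= 0.
Proof.
move=> dphi Vx Nx dx de Sl Sh S0 conv.
have fC := defining_C21 dphi.
have Ax := img_mem Vx dx.
have fx : loc phi (chart c x) = 0 by apply/(defining_zero dphi Ax); rewrite chart_invK.
have [r [C [r0 C0 sub key]]] := key_estimate fC Sl Sh S0 conv Ax fx de.
(* The bound r / 4 gives 2 eps < r, the bound 1 gives eps^2 <= eps, and the last one gives both 8 C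
   eps <= 1 and 6 C eps < 1/2. *)
pose eps := Num.min (r / 4) (Num.min 1 (16 * (C + 1))^-1).
have C1 : 0 < C + 1 by rewrite ltr_wpDl.
have e0 : 0 < eps.
  by rewrite !lt_min divr_gt0 // ltr01 invr_gt0 mulr_gt0.
have er : eps <= r / 4 by rewrite ge_min lexx.
have e1 : eps <= 1 by rewrite !ge_min lexx orbT.
have eC : eps * (16 * (C + 1)) <= 1.
  by rewrite -ler_pdivlMr ?mulr_gt0 // div1r !ge_min lexx !orbT.
exists eps => // y a b gam ye dy0 gf b1.
have conf := geodesic_confined dx (fun w h => img_sub (sub w h))
  (fun w v h => (key w v h).1) C0 e0 _ _ gf b1 ye.
have {}conf t : 0 <= t <= 1 -> [/\ dom c (gam t), `|chart c x - chart c (gam t)| <= r &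
    `|derive1 (chart c \o gam) t| <= 2 * eps].
  apply: conf; first by move: er r0; clear; lra.
  have : 0 <= eps * C by rewrite mulr_ge0 // ltW.
  by move: eC e0; clear; move=> *; lra.
set u := chart c \o gam in conf *; set u' := derive1 u in conf *.
case: gf => [/andP[a0 b0] geo g0 dy].
have Hd (t : R) : 0 <= t <= 1 -> [/\ img V (u t), is_derive t 1 u (u' t) &
    is_derive t 1 u' (- spray G c (u t, u' t))].
  move=> /[dup] /conf[dt xt _] /andP[t0 t1].
  have tab : a < t < b by rewrite (lt_le_trans a0 t0) (le_lt_trans t1 b1).
  by have [h1 h2] := geodesic_is_derive geo tab dt; split=> //; exact: sub.
have [d1t _ _] := conf 1 (introT andP (conj ler01 (lexx 1))).
have <- : loc phi (u 1) = phi (gam 1) by rewrite /u /= chart_invK.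
(* With |u'| <= 2 eps, the key estimate has coefficients at most 4 C eps^2 and 2 C eps; their sum k
   is at most 6 C eps. *)
pose k := C * (4 * eps ^+ 2 + 2 * eps).
apply: (@second_order_comparison _ (loc phi \o u)
   (fun t => d1 (pd phi) (u t) (u' t))
   (fun t => hess (pd phi) (pd2 phi) (spray G c) (u t) (u' t)) k).
- by rewrite mulr_ge0 // addr_ge0 // mulr_ge0 ?exprn_ge0 // ltW.
- have : k <= C * (6 * eps).
    rewrite ler_wpM2l //.
    have : eps ^+ 2 <= eps by rewrite expr2 ler_piMl // ltW.
    by clear; lra.
  by move: eC e0; clear; move=> *; lra.
- by move=> t t01; have [At dut _] := Hd t t01; exact: (C21_curve1 fC At dut).
- move=> t t01; have [At dut du't] := Hd t t01.
  apply: (is_derive_eq (C21_curve2 fC At dut du't)).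
  by rewrite d1N addrC.
- by rewrite /u /= g0.
- by rewrite /u' dy /u /= g0.
- move=> t t01; have [_ xt vt] := conf t t01.
  apply: (le_trans (key _ _ xt).2); rewrite /k -mulrA ler_wpM2l //=.
  set p := `|_|; set q := `|d1 _ _ _|; set v := `|u' t| in vt *.
  have v0 : 0 <= v by exact: normr_ge0.
  have p0 : 0 <= p by exact: normr_ge0.
  have q0 : 0 <= q by exact: normr_ge0.
  have v2 : v ^+ 2 <= 4 * eps ^+ 2.
    have -> : 4 * eps ^+ 2 = (2 * eps) ^+ 2 by ring.
    by rewrite lerXn2r // nnegrE mulr_ge0 // ltW.
  have h1 := ler_wpM2l p0 v2; have h2 := ler_wpM2l q0 vt.
  have h3 : 0 <= q * (4 * eps ^+ 2)
    by apply: mulr_ge0 => //; apply: mulr_ge0 => //; exact: sqr_ge0.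
  have h4 : 0 <= p * (2 * eps) by rewrite !mulr_ge0 // ltW.
  by move: h1 h2 h3 h4; clear; move=> *; lra.
Qed.

(** At each point z of N in V the hypothesis concerns another function phi'. Both functions increase
    along nu z, so the factors in [level_hess] with e = nu z are positive and the sign of the
    Hessian passes from phi' to [phi]. *)
Lemma infinitesimal_hess (F : TMfun m) (N U V : set M) (nu : vfield m) phi z0 :
  (forall x, (U `&` N) x -> infinitesimally_convex_hypersurface F N U nu x) ->
  inner_defining_function N U nu z0 V phi ->
  forall w y, img V w -> loc phi w = 0 -> d1 (pd phi) w y = 0 -> y <> 0 ->
    hess (pd phi) (pd2 phi) (spray F c) w y <= 0.
Proof.
move=> hconv [_ VU dphi pos] w y Vw fw dy0 y0.
have Nz : N (chart_inv c w) by exact/(defining_zero dphi Vw).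
case: Vw => z [Vz dz] zw; rewrite -{}zw in fw dy0 Nz *.
rewrite chart_invK // in Nz.
have [V' [phi' [[V'z _ dphi' pos'] H]]] := hconv z (conj (VU z Vz) Nz).
have ty : tangent_space N c z y by apply/(tangent_d1 y dphi Vz Nz dz).
have [h hh h0] := H c y dz ty y0.
have Eh := is_hessian_hess dphi' V'z dz hh.
have e0 := pos z c (conj Vz Nz) dz; have e0' := pos' z c (conj V'z Nz) dz.
rewrite (fdiff_d1 dphi) // in e0; rewrite (fdiff_d1 dphi') // in e0'.
have [fC' fC ff] := defining_pair dphi' dphi.
have Az : (img V' `&` img V) (chart c z) by split; exact: img_mem.
have fz' : loc phi' (chart c z) = 0.
  by apply/(defining_zero dphi' (img_mem V'z dz)); rewrite chart_invK.
have dy0' : d1 (pd phi') (chart c z) y = 0.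
  exact/(tangent_d1 y dphi' V'z Nz dz).
have := level_hess fC' fC ff (spray F c) Az fz' e0' dy0'.
rewrite -Eh => E.
rewrite -(pmulr_lle0 _ e0') E.
by rewrite pmulr_rle0.
Qed.

Lemma exp_image_disjoint (G : TMfun m) (V : set M) phi x (eps : R) (O : set vec) :
  (forall y a b gam, `|y| <= eps -> d1 (pd phi) (chart c x) y = 0 ->
     geodesic_from G c x y a b gam -> 1 < b -> phi (gam 1) <= 0) ->
  (forall y, O y -> `|y| <= eps /\ d1 (pd phi) (chart c x) y = 0) ->
  exp_image G c x O `&` [set z | V z /\ 0 < phi z] = set0.
Proof.
move=> H HO; apply/seteqP; split=> // q [[y [a [b [gam [Oy gf b1 <-]]]]] [_ /=]].
have [ye dy] := HO y Oy.
by rewrite ltNge (H y a b gam).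
Qed.

End Local.

Lemma locally_convex_at {R : realType} {n : nat} {M : topologicalType}
    (m : smooth_structure R n M) (F : TMfun m) (N U : set M) (nu : vfield m) (x : M) :
  finsler_metric F -> N x ->
  (forall z, (U `&` N) z -> infinitesimally_convex_hypersurface F N U nu z) ->
  locally_convex_hypersurface F N U nu x.
Proof.
move=> hF Nx hconv V phi inn c dx.
have [Vx _ dphi _] := inn.
have [e de] := defining_transverse dphi Vx Nx dx.
have conv := infinitesimal_hess (c := c) hconv inn.
have sub w : (chart c @` (V `&` dom c)) w -> chart_img c w by exact: img_sub.
have [eps1 e1 H1] : exists2 eps : R, 0 < eps & forall y a b gam, `|y| <= eps ->
    d1 (fun i => 'D_(delta_mx 0 i) (phi \o chart_inv c)) (chart c x) y = 0 ->
    geodesic_from F c x y a b gam -> 1 < b -> phi (gam 1) <= 0.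
  apply: (geodesic_below dphi Vx Nx dx de) => //.
  - by move=> z i /sub zc z0; apply: spray_llip.
  - by move=> w y l /sub wc; exact: spray_homog.
  - by move=> w /sub; exact: spray0.
have [eps2 e2 H2] : exists2 eps : R, 0 < eps & forall y a b gam, `|y| <= eps ->
    d1 (fun i => 'D_(delta_mx 0 i) (phi \o chart_inv c)) (chart c x) y = 0 ->
    geodesic_from (reversed F) c x y a b gam -> 1 < b -> phi (gam 1) <= 0.
  apply: (geodesic_below dphi Vx Nx dx de) => //.
  - move=> z i /sub zc z0; have sz : slit_Tdom c z by [].
    apply: (@llip_near_eq _ _ _ (fun w : 'rV[R]_n * 'rV[R]_n =>
        spray F c (fiber_scale (- 1) w) 0 i)).
      by apply: filterS (near_slit sz) => w sw; rewrite spray_reversed // reflE.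
    have lr : llip (fiber_scale (- 1) : 'rV[R]_n * 'rV[R]_n -> _) z.
      apply: (@llip_lipschitz _ _ _ _ 1) => v w.
      by rewrite !reflE !prod_normE /= -opprD normrN mul1r.
    exact: (llip_comp lr (spray_llip hF i (slit_refl sz))).
  - move=> w y l /sub wc y0 l0.
    have ny0 : - y <> 0 by move=> /eqP; rewrite oppr_eq0 => /eqP.
    rewrite !spray_reversed //=.
      by rewrite -scalerN spray_homog.
    by split=> //= /eqP; rewrite scaler_eq0 gt_eqF //= => /eqP.
  - by move=> w /sub; exact: spray0_reversed.
  (* For the reversed spray the Hessian at y is that of [F] at the tangent vector - y: the
     second-order term is even and the spray is evaluated at - y. *)
  - move=> w y Vw fw dy0 y0.
    have ny0 : - y <> 0 by move=> /eqP; rewrite oppr_eq0 => /eqP.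
    have := conv w (- y) Vw fw; rewrite d1N dy0 oppr0 => /(_ erefl ny0).
    rewrite /hess -{1}scaleN1r d2Z sqrrN expr1n mul1r spray_reversed //.
    by split=> //=; exact: sub.
(* A radius valid for the geodesics of both metrics. *)
exists (ball (0 : 'rV[R]_n) (Num.min eps1 eps2)).
  by apply: nbhsx_ballx; rewrite lt_min e1.
have HO y : (ball (0 : 'rV[R]_n) (Num.min eps1 eps2) `&` tangent_space N c x) y ->
    `|y| <= Num.min eps1 eps2 /\
    d1 (fun i => 'D_(delta_mx 0 i) (phi \o chart_inv c)) (chart c x) y = 0.
  rewrite -ball_normE /ball_ /= sub0r normrN => -[/ltW ye ty]; split=> //.
  exact/(tangent_d1 y dphi Vx Nx dx).
move=> O' inner; split.
  rewrite /inner; apply: (exp_image_disjoint V H1) => y /HO[+ dy].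
  by rewrite le_min => /andP[].
rewrite /inner; apply: (exp_image_disjoint V H2) => y /HO[+ dy].
by rewrite le_min => /andP[].
Qed.

Unset Implicit Arguments.
Set Strict Implicit.
Set Printing Implicit Defensive.

Theorem theorem1p1 (R : realType) (n : nat) (M : topologicalType)
    (m : smooth_structure R n M) (F : TMfun m) (N U : set M)
    (nu : vfield m) (p : M)
    (hF : finsler_metric F)
    (hN : hypersurface m N)
    (hp : N p)
    (hU : open_nbhs p U)
    (hnu : transverse_field N U nu)
    (hconv : forall x, (U `&` N) x -> infinitesimally_convex_hypersurface F N U nu x) :
  locally_convex_hypersurface F N U nu p /\
  (forall x, (U `&` N) x -> locally_convex_hypersurface F N U nu x).
Proof.
split; first exact: locally_convex_at.
by move=> x [_ Nx]; exact: locally_convex_at.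
Qed.
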